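(* The Crank--Nicolson finite element scheme described in the context is $L^2$-stable: there are constants $c>0$ and $k_0>0$, independent of $h$, $k$, $n$, of the starting value $U^0\in S_h$ and of $F$, such that if $k\le k_0$ and $U^0,U^1,\dots,U^N\in S_h$ satisfy the scheme, then $$\|U^n\|\le c\,\|U^0\|+c\max_{0\le m\le N-1}\|F(r^{m+\frac12})\|,\qquad 1\le n\le N.$$
   Context: Let $r_{\min}<r_{\max}$, $\theta_{\min}<\theta_{\max}$, $\mathfrak{D}=(0,1)\times(\theta_{\min},\theta_{\max})$ with points $(y,\theta)$, and $\nabla v=(v_y,v_\theta)^t$. $(u,v)=\int_{\mathfrak D}u\bar v$, $\|\cdot\|$ is the $L^2(\mathfrak D)$ norm, $\|\cdot\|_m$ the norm of the complex Sobolev space $H^m(\mathfrak D)$. $\tilde H_0^1(\mathfrak D)$ is the space of $v\in H^1(\mathfrak D)$ vanishing on $y=0$, $\theta=\theta_{\min}$ and $\theta=\theta_{\max}$. Coefficients (smooth on $[r_{\min},r_{\max}]\times\overline{\mathfrak D}$): $D=D(r,y,\theta)$ is a $2\times2$ real symmetric matrix with $\det D>0$ everywhere; $b=(b_1,b_2)(r,y,\theta)$ is real, with $b\nabla v=b_1v_y+b_2v_\theta$; $\beta=\beta(r,y,\theta)$, $F=F(r,y,\theta)$, $\lambda=\lambda(r,\theta)$ are complex-valued; and $b_1(r,1,\theta)-2\,\mathrm{Re}\,\lambda(r,\theta)\le0$ for all $r,\theta$. Form: for $v,w\in\tilde H_0^1(\mathfrak D)$, $$\mathcal A(r;v,w)=(D(r)\nabla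 v,\nabla w)-\mathrm i\Big(\int_{\theta_{\min}}^{\theta_{\max}}\lambda(r,\theta)v(1,\theta)\overline{w}(1,\theta)\,d\theta-(b(r)\nabla v,w)\Big).$$ Finite elements: $\tau\ge1$ is an integer; for $h\in(0,h_\star]$, $S_h\subset\tilde H_0^1(\mathfrak D)$ is a finite-dimensional space of complex-valued functions that are piecewise polynomials of degree $\le\tau$ over a partition of $\mathfrak D$ of mesh size $h$, such that, with constants independent of $h$, $\inf_{\chi\in S_h}\{\|v-\chi\|+h\|v-\chi\|_1\}\le Ch^{s+1}\|v\|_{s+1}$ for all $v\in H^{s+1}(\mathfrak D)\cap\tilde H_0^1(\mathfrak D)$, $s=0,\dots,\tau$, and $\|\phi\|_1\le Ch^{-1}\|\phi\|$ for all $\phi\in S_h$. Scheme: $N>1$ is an integer, $k=(r_{\max}-r_{\min})/N$, $r^n=r_{\min}+nk$, $r^{n+\frac12}=\frac{r^n+r^{n+1}}2$. Given $U^n\in S_h$, $U^{n+1}\in S_h$ satisfies, for all $\phi\in S_h$ and $0\le n\le N-1$, $$\Big(\tfrac{U^{n+1}-U^n}{k},\phi\Big)=-\mathrm i\,\mathcal A\Big(r^{n+\frac12};\tfrac{U^{n+1}+U^n}2,\phi\Big)+\mathrm i\Big(\beta(r^{n+\frac12})\tfrac{U^{n+1}+U^n}2,\phi\Big)+(F(r^{n+\frac12}),\phi).$$ *)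

(* Defs.v *)
From HB Require Import structures.
From mathcomp Require Export all_boot all_order all_algebra.
From mathcomp Require Export complex.
From mathcomp Require Export all_classical all_reals all_analysis.

Set Implicit Arguments.
Unset Strict Implicit.
Unset Printing Implicit Defensive.

Export Order.TTheory GRing.Theory Num.Theory.
Export numFieldNormedType.Exports.

Global Open Scope classical_set_scope.
Global Open Scope ring_scope.

(** Smoothness *)

(* On a finite-dimensional V, asking for all directional derivatives of f to
   exist everywhere and to be C^n is the same as f being C^(n+1). *)
Fixpoint Cn (R : realType) (V : normedModType R) (n : nat) (f : V -> R) : Prop :=
  match n with
  | 0 => continuous f
  | n'.+1 => continuous f /\
      forall v : V, (forall x, derivable f x v) /\ Cn n' (fun x => 'D_v f x)
  end.

Definition smooth (R : realType) (V : normedModType R) (f : V -> R) : Prop :=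
  forall n, Cn n f.

Definition smoothC (R : realType) (V : normedModType R) (f : V -> R[i]) : Prop :=
  smooth (fun x => complex.Re (f x)) /\ smooth (fun x => complex.Im (f x)).

(* Smoothness on a closed box: restriction of a function smooth on the whole
   space. *)
Definition smooth_on (R : realType) (V : normedModType R) (B : set V)
    (f : V -> R) : Prop :=
  exists2 g : V -> R, smooth g & {in B, f =1 g}.

Definition smoothC_on (R : realType) (V : normedModType R) (B : set V)
    (f : V -> R[i]) : Prop :=
  exists2 g : V -> R[i], smoothC g & {in B, f =1 g}.

(** Complex-valued integration and L^2 *)

Section L2.
Context (R : realType) (d : measure_display) (T : measurableType d).
Variables (mu : {measure set T -> \bar R}) (A : set T).

Definition cintegral (f : T -> R[i]) : R[i] :=
  Complex (\int[mu]_(x in A) complex.Re (f x)) (\int[mu]_(x in A) complex.Im (f x)).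

Definition L2 (v : T -> R[i]) : Prop :=
  [/\ measurable_fun A (fun x => complex.Re (v x)),
      measurable_fun A (fun x => complex.Im (v x)) &
      mu.-integrable A (fun x => ((ComplexField.Normc.normc (v x)) ^+ 2)%:E)].

Definition L2norm (v : T -> R[i]) : R :=
  Num.sqrt (\int[mu]_(x in A) (ComplexField.Normc.normc (v x)) ^+ 2).

Definition L2inner (u v : T -> R[i]) : R[i] :=
  cintegral (fun x => u x * (v x)^*%C).

Definition L2inner_vec (n : nat) (u v : T -> 'cV[R[i]]_n) : R[i] :=
  cintegral (fun x => \sum_(i < n) u x i 0 * (v x i 0)^*%C).

End L2.

Definition leb2 (R : realType) :
    {measure set (measurableTypeR R * measurableTypeR R) -> \bar R} :=
  (@lebesgue_measure R \x @lebesgue_measure R)%E.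
Arguments leb2 : clear implicits.

(** The rectangle (0,1) x (tmin,tmax); its points are pairs (y, theta). *)

Section Rectangle.
Context (R : realType) (tmin tmax : R).
Local Notation C := R[i].
Local Notation leb := (@lebesgue_measure R).

Definition rect : set (R * R) := `]0, 1[ `*` `]tmin, tmax[.
Definition crect : set (R * R) := `[0, 1] `*` `[tmin, tmax].

Definition inner (u v : R * R -> C) : C := L2inner (leb2 R) rect u v.
Definition norm0 (v : R * R -> C) : R := L2norm (leb2 R) rect v.

(* Classical derivative: i times in y and j times in theta. *)
Definition pderiv (i j : nat) (f : R * R -> R) : R * R -> R :=
  iter i (fun g => 'D_((1, 0) : R * R) g)
    (iter j (fun g => 'D_((0, 1) : R * R) g) f).

Definition pderivC (i j : nat) (f : R * R -> C) (p : R * R) : C :=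
  Complex (pderiv i j (fun x => complex.Re (f x)) p)
          (pderiv i j (fun x => complex.Im (f x)) p).

Definition test_function (phi : R * R -> R) : Prop :=
  smooth phi /\
  exists K : set (R * R), [/\ compact K, K `<=` rect &
    forall p, ~ K p -> phi p = 0].

Definition is_wderiv (i j : nat) (v g : R * R -> C) : Prop :=
  L2 (leb2 R) rect g /\
  forall phi, test_function phi ->
    cintegral (leb2 R) rect (fun p => v p * (pderiv i j phi p)%:C%C) =
    (-1) ^+ (i + j) * cintegral (leb2 R) rect (fun p => g p * (phi p)%:C%C).

(* A representative of the weak derivative, unique up to a null set; the
   default value is only used when there is no weak derivative in L^2. *)
Definition wderiv (i j : nat) (v : R * R -> C) : R * R -> C :=
  xget (fun=> 0) [set g | is_wderiv i j v g].

Definition grad (v : R * R -> C) (p : R * R) : 'cV[C]_2 :=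
  \col_(i < 2) (if i == 0 then wderiv 1 0 v p else wderiv 0 1 v p).

Definition Hm (m : nat) (v : R * R -> C) : Prop :=
  L2 (leb2 R) rect v /\
  forall i j : nat, (i + j <= m)%N -> exists g, is_wderiv i j v g.

Definition Hnorm (m : nat) (v : R * R -> C) : R :=
  Num.sqrt (\sum_(i < m.+1) \sum_(j < m.+1 | (i + j <= m)%N)
    (norm0 (wderiv i j v)) ^+ 2).

(* Square-integrable functions on the boundary, and the distance to them; only
   the values of g on the four sides matter. *)
Definition bdry_L2 (g : R * R -> C) : Prop :=
  [/\ L2 leb `[tmin, tmax] (fun t => g (0, t)),
      L2 leb `[tmin, tmax] (fun t => g (1, t)),
      L2 leb `[0, 1] (fun y => g (y, tmin)) &
      L2 leb `[0, 1] (fun y => g (y, tmax))].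

Definition bdry_norm (g : R * R -> C) : R :=
  Num.sqrt
    ((L2norm leb `[tmin, tmax] (fun t => g (0, t))) ^+ 2 +
     (L2norm leb `[tmin, tmax] (fun t => g (1, t))) ^+ 2 +
     (L2norm leb `[0, 1] (fun y => g (y, tmin))) ^+ 2 +
     (L2norm leb `[0, 1] (fun y => g (y, tmax))) ^+ 2).

(* The trace operator H^1 -> L^2(boundary) is the continuous extension of the
   restriction of functions smooth up to the boundary: g is the trace of v when
   such functions w_n converge to v in H^1 and their restrictions converge to
   g in L^2(boundary). *)
Definition is_trace (v g : R * R -> C) : Prop :=
  [/\ Hm 1 v, bdry_L2 g &
    exists w : nat -> R * R -> C,
      [/\ forall n, smoothC (w n),
          (fun n => norm0 (w n \- v)) @ \oo --> (0 : R),
          (fun n => norm0 (pderivC 1 0 (w n) \- wderiv 1 0 v)) @ \oo --> (0 : R),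
          (fun n => norm0 (pderivC 0 1 (w n) \- wderiv 0 1 v)) @ \oo --> (0 : R) &
          (fun n => bdry_norm (w n \- g)) @ \oo --> (0 : R)]].

Definition trace (v : R * R -> C) : R * R -> C :=
  xget (fun=> 0) [set g | is_trace v g].

Definition Htilde (v : R * R -> C) : Prop :=
  Hm 1 v /\
  exists g, [/\ is_trace v g,
    {ae leb, forall t, t \in `[tmin, tmax] -> g (0, t) = 0},
    {ae leb, forall y, y \in `[0, 1] -> g (y, tmin) = 0} &
    {ae leb, forall y, y \in `[0, 1] -> g (y, tmax) = 0}].

Definition b_grad (b : R * R -> 'rV[R]_2) (v : R * R -> C) (p : R * R) : C :=
  (map_mx (real_complex R) (b p) *m grad v p) 0 0.

Definition D_grad (D : R * R -> 'M[R]_2) (v : R * R -> C) (p : R * R) :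
    'cV[C]_2 :=
  map_mx (real_complex R) (D p) *m grad v p.

Definition formA (D : R * R -> 'M[R]_2) (b : R * R -> 'rV[R]_2)
    (lam : R -> C) (v w : R * R -> C) : C :=
  L2inner_vec (leb2 R) rect (D_grad D v) (grad w)
  - 'i%C * (cintegral leb `[tmin, tmax]
              (fun t => lam t * trace v (1, t) * (trace w (1, t))^*%C)
            - inner (b_grad b v) w).

(** Finite element spaces *)

Definition diam (K : set (R * R)) : R :=
  sup [set Num.sqrt ((p.1 - q.1) ^+ 2 + (p.2 - q.2) ^+ 2) | p in K & q in K].

(* Elements are open and partition the rectangle up to a null set; h is the
   largest diameter. *)
Definition is_partition (h : R) (m : nat) (K : 'I_m -> set (R * R)) : Prop :=
  [/\ forall i, open (K i) /\ K i `<=` rect,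
      forall i j, i != j -> K i `&` K j = set0,
      (leb2 R).-negligible (rect `\` \bigcup_i K i) &
      h = \big[Num.max/0]_(i < m) diam (K i)].

Definition poly_on (tau : nat) (K : set (R * R)) (v : R * R -> C) : Prop :=
  exists a : nat -> nat -> C, forall p, K p ->
    v p = \sum_(i < tau.+1) \sum_(j < tau.+1 | (i + j <= tau)%N)
            a i j * (p.1%:C%C) ^+ i * (p.2%:C%C) ^+ j.

Definition finite_dim_space (S : set (R * R -> C)) : Prop :=
  exists (m : nat) (e : 'I_m -> R * R -> C),
    S = [set (fun p => \sum_(i < m) a i * e i p) | a in [set: 'I_m -> C]].

Definition fe_space (tau : nat) (h : R) (S : set (R * R -> C)) : Prop :=
  [/\ finite_dim_space S,
      S `<=` [set v | Htilde v] &
      exists (m : nat) (K : 'I_m -> set (R * R)),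
        is_partition h K /\ forall v, S v -> forall i, poly_on tau (K i) v].

Definition approximation_property (tau : nat) (hstar : R)
    (Sh : R -> set (R * R -> C)) : Prop :=
  exists c : R, forall h, 0 < h <= hstar -> forall s, (s <= tau)%N ->
    forall v, Hm s.+1 v -> Htilde v ->
      inf [set norm0 (v \- chi) + h * Hnorm 1 (v \- chi) | chi in Sh h]
        <= c * h ^+ s.+1 * Hnorm s.+1 v.

Definition inverse_property (hstar : R) (Sh : R -> set (R * R -> C)) : Prop :=
  exists c : R, forall h, 0 < h <= hstar ->
    forall phi, Sh h phi -> Hnorm 1 phi <= c * h^-1 * norm0 phi.

End Rectangle.

(** The scheme *)

Section Scheme.
Context (R : realType) (rmin rmax tmin tmax : R).
Local Notation C := R[i].

Definition step (N : nat) : R := (rmax - rmin) / N%:R.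
Definition node (N n : nat) : R := rmin + n%:R * step N.
Definition midnode (N n : nat) : R := (node N n + node N n.+1) / 2.

Definition cn_scheme (D : R -> R * R -> 'M[R]_2) (b : R -> R * R -> 'rV[R]_2)
    (beta F : R -> R * R -> C) (lam : R -> R -> C)
    (S : set (R * R -> C)) (N : nat) (U : nat -> R * R -> C) : Prop :=
  forall n, (n < N)%N -> forall phi, S phi ->
    let r := midnode N n in
    let Umid := fun p => (U n.+1 p + U n p) / 2 in
    inner tmin tmax (fun p => (U n.+1 p - U n p) / (step N)%:C%C) phi =
      - 'i%C * formA tmin tmax (D r) (b r) (lam r) Umid phi
      + 'i%C * inner tmin tmax (fun p => beta r p * Umid p) phi
      + inner tmin tmax (F r) phi.

End Scheme.

(* Main.v *)
Require Import Defs.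
From mathcomp Require Import measurable_realfun ring lra.

Set Implicit Arguments.
Unset Strict Implicit.
Unset Printing Implicit Defensive.

(** Stability is an energy argument.  The scheme is tested with the midpoint
    [V = (U^(n+1) + U^n) / 2], which lies in [S_h], and real parts are taken.
    The left-hand side gives [(|U^(n+1)|^2 - |U^n|^2) / (2k)].  The term with
    [D] disappears because [D] is real symmetric, so that [(D grad V, grad V)]
    is real; the terms with [beta] and [F] are bounded by squares of L^2 norms.
    What remains is [Re (b grad V, V)] minus the integral of
    [Re lambda |V|^2] over the side [y = 1].  Since
    [2 Re (b grad V, V) = (b, grad |V|^2)], integrating by parts turns it into
    half of
      [int_(y=1) (b_1 - 2 Re lambda) |V|^2 - int (div b) |V|^2],
    whose first integral is nonpositive by the sign condition and whose second
    one is at most a constant times [|V|^2] ([energy]).  Hence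
      [|U^(n+1)|^2 <= (1 + 4Kk) |U^n|^2 + 2k max |F|^2]
    as soon as [k K <= 1/2] ([crank_nicolson_step]), with a constant [K] that
    depends on the coefficients only, and the discrete Gronwall lemma
    concludes.  Only the L^2 norm of [V] enters these bounds, never its
    gradient, so the constants are independent of [h].

    The analytic work is in the integration by parts for [V] in [H^1].  The
    trace comes with smooth functions that converge to [V] in [H^1] and to the
    trace on the boundary.  For smooth functions the identity is Fubini's theorem
    followed by the fundamental theorem of calculus ([smooth_ibp_dy],
    [smooth_ibp_dt]); every term of it is a quadratic expression that is
    continuous for the L^2 norm ([cvg_Rintegral_mul]), so it passes to the limit
    ([trace_ibp_dy], [trace_ibp_dt]).  In this form the weak derivatives enter
    only as L^2 limits of classical ones.  Real and imaginary parts never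
    interact in these identities, so they are proved for each part separately. *)

(** * Square-integrable real functions *)

Section SquareIntegrable.
Context (R : realType) (d : measure_display) (T : measurableType d).
Variables (mu : {measure set T -> \bar R}) (A : set T).
Hypothesis mA : measurable A.

Definition integrableR (f : T -> R) : Prop := mu.-integrable A (EFin \o f).

Definition sqint (f : T -> R) : Prop :=
  measurable_fun A f /\ integrableR (fun x => f x ^+ 2).

Lemma integrableR_dom (f g : T -> R) : measurable_fun A f -> integrableR g ->
  (forall x, A x -> `|f x| <= g x) -> integrableR f.
Proof.
move=> mf ig fg; apply: le_integrable ig => //; first exact/measurable_EFinP.
by move=> x Ax /=; rewrite lee_fin (le_trans (fg x Ax)) // ler_norm.
Qed.

Lemma integrableR_D (f g : T -> R) :
  integrableR f -> integrableR g -> integrableR (fun x => f x + g x).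
Proof. by move=> iF ig; have := integrableD mA iF ig. Qed.

Lemma integrableR_Z (c : R) (f : T -> R) :
  integrableR f -> integrableR (fun x => c * f x).
Proof. by move=> iF; have := integrableZl mA c iF. Qed.

Lemma integrableR_N (f : T -> R) :
  integrableR f -> integrableR (fun x => - f x).
Proof.
move=> /(integrableR_Z (-1)); congr integrableR.
by apply/funext => x; rewrite mulN1r.
Qed.

Lemma integrableR_B (f g : T -> R) :
  integrableR f -> integrableR g -> integrableR (fun x => f x - g x).
Proof. by move=> iF /integrableR_N; exact: integrableR_D. Qed.

Lemma integrableR_meas (f : T -> R) : integrableR f -> measurable_fun A f.
Proof. by move=> /(measurable_int mu)/measurable_EFinP. Qed.

Lemma integrableR_bddM (phi f : T -> R) (M : R) : measurable_fun A phi ->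
  (forall x, A x -> `|phi x| <= M) -> integrableR f ->
  integrableR (fun x => phi x * f x).
Proof.
move=> mphi phiM iF.
have iF' : integrableR (fun x => M * `|f x|).
  by apply: integrableR_Z; have := integrable_norm iF.
apply: (integrableR_dom _ iF').
  by apply: measurable_funM => //; exact: integrableR_meas.
by move=> x Ax; rewrite normrM ler_wpM2r // phiM.
Qed.

(** Dominated by [f^2 + g^2]. *)
Lemma sqint_mul (f g : T -> R) : sqint f -> sqint g ->
  integrableR (fun x => f x * g x).
Proof.
move=> [mf iF] [mg ig]; apply: (integrableR_dom _ (integrableR_D iF ig)).
  exact: measurable_funM.
move=> x _; rewrite ler_norml; apply/andP; split;
  have := sqr_ge0 (f x + g x); have := sqr_ge0 (f x - g x);
  have := sqr_ge0 (f x); have := sqr_ge0 (g x); nra.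
Qed.

Lemma sqint_D (f g : T -> R) : sqint f -> sqint g -> sqint (fun x => f x + g x).
Proof.
move=> sf sg; split; first by apply: measurable_funD; [case: sf|case: sg].
have -> : (fun x => (f x + g x) ^+ 2) =
    (fun x => f x ^+ 2 + 2 * (f x * g x) + g x ^+ 2).
  by apply/funext => x; ring.
apply: integrableR_D; last by case: sg.
by apply: integrableR_D; [case: sf|apply: integrableR_Z; exact: sqint_mul].
Qed.

Lemma sqint_bddM (phi f : T -> R) (M : R) : measurable_fun A phi ->
  (forall x, A x -> `|phi x| <= M) -> sqint f ->
  sqint (fun x => phi x * f x).
Proof.
move=> mphi phiM [mf iF]; split; first exact: measurable_funM.
have -> : (fun x => (phi x * f x) ^+ 2) = (fun x => phi x ^+ 2 * f x ^+ 2).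
  by apply/funext => x; ring.
apply: (@integrableR_bddM _ _ (M ^+ 2)) => //.
  by have := measurable_funX 2 mphi.
by move=> x Ax; rewrite normrX lerXn2r ?nnegrE ?phiM // (le_trans _ (phiM x Ax)).
Qed.

Lemma sqint_Z (c : R) (f : T -> R) : sqint f -> sqint (fun x => c * f x).
Proof. by apply: (@sqint_bddM _ _ `|c|). Qed.

Lemma sqint_B (f g : T -> R) : sqint f -> sqint g -> sqint (fun x => f x - g x).
Proof.
move=> sf sg; have := sqint_D sf (sqint_Z (-1) sg).
by congr sqint; apply/funext => x; rewrite mulN1r.
Qed.

Lemma bounded_sqint (f : T -> R) (M : R) : (mu A < +oo)%E ->
  measurable_fun A f -> (forall x, A x -> `|f x| <= M) -> sqint f.
Proof.
move=> Afin mf fM.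
have -> : f = fun x => f x * 1 by apply/funext => x; rewrite mulr1.
apply: (sqint_bddM mf fM); split; first exact: measurable_cst.
apply: measurable_bounded_integrable => //.
by exists 1; split=> // y y1 x _ /=; rewrite expr1n normr1 ltW.
Qed.

(** The quadratic [s |-> int (s f + g)^2] is nonnegative, hence has a nonpositive
    discriminant. *)
Lemma cauchy_schwarz (f g : T -> R) : sqint f -> sqint g ->
  (\int[mu]_(x in A) (f x * g x)) ^+ 2 <=
  (\int[mu]_(x in A) f x ^+ 2) * (\int[mu]_(x in A) g x ^+ 2).
Proof.
move=> sf sg; have ifg := sqint_mul sf sg.
set a := \int[mu]_(x in A) f x ^+ 2; set c := \int[mu]_(x in A) g x ^+ 2.
set p := \int[mu]_(x in A) (f x * g x).
have a0 : 0 <= a by apply: Rintegral_ge0 => x _; exact: sqr_ge0.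
have c0 : 0 <= c by apply: Rintegral_ge0 => x _; exact: sqr_ge0.
have H s : 0 <= s ^+ 2 * a + 2 * s * p + c.
  have : 0 <= \int[mu]_(x in A) (s * f x + g x) ^+ 2.
    by apply: Rintegral_ge0 => x _; exact: sqr_ge0.
  have -> : (fun x => (s * f x + g x) ^+ 2) =
      (fun x => (s ^+ 2 * f x ^+ 2 + 2 * s * (f x * g x)) + g x ^+ 2).
    by apply/funext => x; ring.
  have [_ if2] := sf; have [_ ig2] := sg.
  rewrite RintegralD //; last exact: integrableR_D (integrableR_Z _ _) (integrableR_Z _ _).
  by rewrite RintegralD ?RintegralZl //; exact: integrableR_Z.
have [a_eq|a_neq] := eqVneq a 0.
  have [->|p0] := eqVneq p 0; first by rewrite expr0n /= mulr_ge0.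
  have := H (- (c + 1) / (2 * p)).
  have -> : 2 * (- (c + 1) / (2 * p)) * p = - (c + 1) by field.
  by rewrite a_eq; lra.
have ap : 0 < a by rewrite lt_def a_neq.
have := H (- p / a).
have -> : (- p / a) ^+ 2 * a + 2 * (- p / a) * p + c = (a * c - p ^+ 2) / a by field.
by rewrite pmulr_lge0 ?invr_gt0 // subr_ge0.
Qed.

Lemma Rintegral_mul_le (f g : T -> R) : sqint f -> sqint g ->
  `|\int[mu]_(x in A) (f x * g x)| <=
  Num.sqrt (\int[mu]_(x in A) f x ^+ 2) * Num.sqrt (\int[mu]_(x in A) g x ^+ 2).
Proof.
move=> sf sg; rewrite -sqrtrM; last by apply: Rintegral_ge0 => x _; exact: sqr_ge0.
by rewrite -sqrtr_sqr ler_wsqrtr // cauchy_schwarz.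
Qed.

(** Joint continuity of [(f, g) |-> int phi f g] for the L^2 norm.  It rests on
    [f_n g_n - f g = (f_n - f)(g_n - g) + f (g_n - g) + g (f_n - f)] and on
    Cauchy-Schwarz for each product. *)
Lemma cvg_Rintegral_mul (phi : T -> R) (M : R) (f g : T -> R) (f_ g_ : nat -> T -> R) :
  measurable_fun A phi -> (forall x, A x -> `|phi x| <= M) ->
  sqint f -> sqint g -> (forall n, sqint (f_ n)) -> (forall n, sqint (g_ n)) ->
  (fun n => Num.sqrt (\int[mu]_(x in A) (f_ n x - f x) ^+ 2)) @ \oo --> (0 : R) ->
  (fun n => Num.sqrt (\int[mu]_(x in A) (g_ n x - g x) ^+ 2)) @ \oo --> (0 : R) ->
  (fun n => \int[mu]_(x in A) (phi x * (f_ n x * g_ n x))) @ \oo -->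
  \int[mu]_(x in A) (phi x * (f x * g x)).
Proof.
move=> mphi phiM sf sg sf_ sg_ cf cg.
set N2 := fun u : T -> R => Num.sqrt (\int[mu]_(x in A) u x ^+ 2).
have phi_le u : sqint u -> N2 (fun x => phi x * u x) <= `|M| * N2 u.
  move=> su; rewrite /N2 -[`|M|]sqrtr_sqr -sqrtrM ?sqr_ge0 // ler_wsqrtr //.
  rewrite -RintegralZl //; last by case: su.
  apply: le_Rintegral => //; first by case: (sqint_bddM mphi phiM su).
    by case: su => _; exact: integrableR_Z.
  move=> x Ax; rewrite exprMn ler_wpM2r ?sqr_ge0 // -[leLHS]real_normK ?num_real //.
  by rewrite lerXn2r ?nnegrE ?phiM // (le_trans _ (phiM x Ax)).
have dist n : `|\int[mu]_(x in A) (phi x * (f x * g x)) -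
    \int[mu]_(x in A) (phi x * (f_ n x * g_ n x))| <=
    `|M| * N2 (fun x => f_ n x - f x) * N2 (fun x => g_ n x - g x)
    + `|M| * N2 f * N2 (fun x => g_ n x - g x)
    + `|M| * N2 g * N2 (fun x => f_ n x - f x).
  have sdf := sqint_B (sf_ n) sf; have sdg := sqint_B (sg_ n) sg.
  have i1 := sqint_mul (sqint_bddM mphi phiM sdf) sdg.
  have i2 := sqint_mul (sqint_bddM mphi phiM sf) sdg.
  have i3 := sqint_mul (sqint_bddM mphi phiM sg) sdf.
  have i4 := integrableR_bddM mphi phiM (sqint_mul sf sg).
  have -> : (fun x => phi x * (f_ n x * g_ n x)) = (fun x =>
     (phi x * (f_ n x - f x)) * (g_ n x - g x) + (phi x * f x) * (g_ n x - g x)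
     + (phi x * g x) * (f_ n x - f x) + phi x * (f x * g x)).
    by apply/funext => x; ring.
  have i12 := integrableR_D i1 i2; have i123 := integrableR_D i12 i3.
  rewrite (RintegralD mA i123 i4) (RintegralD mA i12 i3) (RintegralD mA i1 i2).
  rewrite opprD addrCA subrr addr0 normrN.
  have N0 u : 0 <= N2 u by exact: sqrtr_ge0.
  have bound u v : sqint u -> sqint v ->
      `|\int[mu]_(x in A) (phi x * u x * v x)| <= `|M| * N2 u * N2 v.
    move=> su sv; apply: le_trans (Rintegral_mul_le (sqint_bddM mphi phiM su) sv) _.
    by rewrite ler_wpM2r ?sqrtr_ge0 // phi_le.
  by rewrite (le_trans (ler_normD _ _)) // lerD ?bound // (le_trans (ler_normD _ _)) // lerD ?bound.
apply/cvgrPdist_le => eps eps0.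
pose b n := `|M| * N2 (fun x => f_ n x - f x) * N2 (fun x => g_ n x - g x)
    + `|M| * N2 f * N2 (fun x => g_ n x - g x)
    + `|M| * N2 g * N2 (fun x => f_ n x - f x).
have b0 : b n @[n --> \oo] --> (0 : R).
  rewrite -[X in _ --> X](_ : `|M| * 0 * 0 + `|M| * N2 f * 0 + `|M| * N2 g * 0 = 0);
    last by rewrite !mulr0 !addr0.
  apply: cvgD; last by apply: cvgMl_tmp.
  apply: cvgD; last by apply: cvgMl_tmp.
  by apply: cvgM => //; apply: cvgMl_tmp.
move/cvgrPdist_le : b0 => /(_ eps eps0); apply: filterS => n.
rewrite sub0r normrN => bn; rewrite (le_trans (dist n)) // (le_trans _ bn) //.
exact: ler_norm.
Qed.

End SquareIntegrable.

(** * Continuous functions and the fundamental theorem of calculus on the rectangle *)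

Section Rectangles.
Context (R : realType).
Local Notation leb := (@lebesgue_measure R).
Local Notation R2 := (measurableTypeR R * measurableTypeR R)%type.

(** The measurable sets of the product are generated by products of
    measurable sets, so the topology of the plane has to be related to them: an
    open set is the union of the countably many squares with rational centre
    and half-side [1/(n+1)] that it contains. *)
Lemma open_measurable2 (U : set (R * R)) : open U -> measurable (U : set R2).
Proof.
move=> oU.
pose B (p q e : R) : set (R * R) := `]p - e, p + e[ `*` `]q - e, q + e[.
pose G (n : nat) (p q : rat) : set (R * R) :=
  if `[< B (ratr p) (ratr q) n.+1%:R^-1 `<=` U >]
  then B (ratr p) (ratr q) n.+1%:R^-1 else set0.
have -> : U = \bigcup_n \bigcup_p \bigcup_q G n p q.
  apply/seteqP; split => [[x y] Uxy|z [n _ [p _ [q _]]]]; last first.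
    by rewrite /G; case: asboolP => // BU; exact: BU.
  have /nbhs_ballP[e /= e0 eU] : nbhs (x, y) U by exact: open_nbhs_nbhs.
  have e20 : 0 < e / 2 by rewrite divr_gt0.
  have [n ne] : exists n : nat, n.+1%:R^-1 < e / 2.
    exists (Num.truncn (e / 2)^-1).
    by rewrite invf_plt ?posrE ?ltr0n //; exact: truncnS_gt.
  have n0 : 0 < (n.+1%:R^-1 : R) by rewrite invr_gt0 ltr0n.
  move: n0 ne; set eps : R := n.+1%:R^-1 => eps0 epse.
  have ratn z : exists p : rat, z - eps < ratr p < z + eps.
    have : z - eps < z + eps by lra.
    by move=> /rat_in_itvoo[p]; rewrite in_itv /= => ?; exists p.
  have [p /andP[p1 p2]] := ratn x; have [q /andP[q1 q2]] := ratn y.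
  exists n => //; exists p => //; exists q => //; rewrite /G -/eps.
  case: asboolP => [_|].
    by split => /=; rewrite in_itv /=; apply/andP; split; lra.
  case; move=> [u v] [/=]; rewrite !in_itv /= => /andP[u1 u2] /andP[v1 v2].
  apply: eU; split => /=; rewrite -ball_normE /ball_ /= ltr_norml;
    by apply/andP; split; lra.
apply: bigcupT_measurable => n; apply: bigcupT_measurable_rat => p.
apply: bigcupT_measurable_rat => q; rewrite /G; case: ifP => // _.
by apply: measurableX; exact: measurable_itv.
Qed.

Lemma continuous_measurable_fun2 (A : set (R * R)) (f : R * R -> R) :
  measurable (A : set R2) -> continuous f -> measurable_fun (A : set R2) f.
Proof.
move=> mA cf; apply: (measurable_funS measurableT) => //.
apply: (measurability _ (RGenOpens.measurableE R)).
move=> _ [_ [a [b ->] <-]]; rewrite setTI; apply: open_measurable2.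
by move/continuousP : cf; apply; exact: interval_open.
Qed.

Lemma compact_continuous_bounded (V : normedModType R) (K : set V) (f : V -> R) :
  compact K -> continuous f -> exists M : R, forall x, K x -> `|f x| <= M.
Proof.
move=> cK cf.
have /compact_bounded : compact (f @` K).
  by apply: continuous_compact => //; exact: continuous_subspaceT.
move=> [M [_ MK]]; exists (M + 1) => x Kx.
by apply: (MK (M + 1)); [rewrite ltrDl|exists x].
Qed.

Lemma measurable_rect (a b : R) : measurable (rect a b : set R2).
Proof. by apply: measurableX; exact: measurable_itv. Qed.

Lemma leb2_rect_fin (a b : R) : (leb2 R (rect a b) < +oo)%E.
Proof.
have -> : leb2 R (rect a b) = (leb `]0%R, 1%R[ * leb `]a, b[)%E.
  by apply: product_measure1E; exact: measurable_itv.
rewrite !lebesgue_measure_itv /= ?lte_fin; case: ifP => _; case: ifP => _;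
  by rewrite ?mul0e ?mule0 ?ltry // -!EFinB -EFinM ltry.
Qed.

Lemma rect_crect (a b : R) : rect a b `<=` crect a b.
Proof.
move=> [y t] [/=]; rewrite !in_itv /= => /andP[y0 y1] /andP[ta tb].
by split; rewrite /= in_itv /=; apply/andP; split; apply: ltW.
Qed.

Lemma compact_crect (a b : R) : compact (crect a b).
Proof. by apply: compact_setX; exact: segment_compact. Qed.

Lemma continuous_rect_sqint (a b : R) (f : R * R -> R) : continuous f ->
  sqint (leb2 R) (rect a b) f.
Proof.
move=> cf; have [M fM] := compact_continuous_bounded (@compact_crect a b) cf.
apply: (@bounded_sqint _ _ _ _ _ (measurable_rect a b) _ M).
- exact: leb2_rect_fin.
- by apply: continuous_measurable_fun2 => //; exact: measurable_rect.
- by move=> x /rect_crect /fM.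
Qed.

Lemma continuous_itv_sqint (a b : R) (f : R -> R) : continuous f ->
  sqint leb `[a, b] f.
Proof.
move=> cf; have [M fM] := compact_continuous_bounded (@segment_compact _ a b) cf.
have fin_ab : (leb `[a, b] < +oo)%E.
  by rewrite lebesgue_measure_itv /=; case: ifP => // _; rewrite -EFinB ltry.
apply: (@bounded_sqint _ _ _ leb _ _ _ M) => //.
by apply: (measurable_funS measurableT) => //; exact: continuous_measurable_fun.
Qed.

Lemma continuous_rect_integrable (a b : R) (f : R * R -> R) : continuous f ->
  integrableR (leb2 R) (rect a b) f.
Proof.
move=> cf; have := sqint_mul (measurable_rect a b)
  (continuous_rect_sqint a b cf)
  (continuous_rect_sqint a b (@cst_continuous _ _ (1 : R))).
by congr integrableR; apply/funext => x; rewrite mulr1.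
Qed.

Lemma continuous_itv_integrable (a b : R) (f : R -> R) : continuous f ->
  integrableR leb `[a, b] f.
Proof.
move=> cf; apply: continuous_compact_integrable; first exact: segment_compact.
exact: continuous_subspaceT.
Qed.

Lemma integral_itvoo_cc (a b : R) (f : R -> R) : continuous f ->
  (\int[leb]_(x in `]a, b[) (f x)%:E = \int[leb]_(x in `[a, b]) (f x)%:E)%E.
Proof.
move=> cf.
have mf I : measurable_fun (I : set R) (EFin \o f).
  apply/measurable_EFinP; apply: (measurable_funS measurableT) => //.
  exact: continuous_measurable_fun.
by rewrite integral_itv_bndo_bndc ?integral_itv_obnd_cbnd.
Qed.

(** Stated on the open interval because the rectangle is open. *)
Lemma FTC_itvoo (a b : R) (F f : R -> R) : a < b -> continuous f ->
  (forall x : R, is_derive x 1 F (f x)) ->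
  (\int[leb]_(x in `]a, b[) (f x)%:E = (F b - F a)%:E)%E.
Proof.
move=> ab cf dF; rewrite integral_itvoo_cc // (@continuous_FTC2 _ f F) //.
- exact: continuous_subspaceT.
- have cF x : {for x, continuous F}.
    by apply: differentiable_continuous; apply/derivable1_diffP; case: (dF x).
  split; first by move=> x _; case: (dF x).
    by apply: cvg_at_right_filter; exact: cF.
  by apply: cvg_at_left_filter; exact: cF.
- by move=> x _; rewrite derive1E; case: (dF x).
Qed.

Lemma continuous_pair (S T V W : topologicalType) (f : S * T -> V)
    (g : W -> S) (h : W -> T) : continuous f ->
  continuous g -> continuous h -> continuous (fun x => f (g x, h x)).
Proof.
move=> cf cg ch x.
apply: (@continuous2_cvg _ _ _ _ _ _ g h (fun y z => f (y, z))).
- have -> : (fun z : S * T => f (z.1, z.2)) = f by apply/funext => -[].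
  exact: cf.
- exact: cg.
- exact: ch.
Qed.

Section Divergence.
Variables (a b : R).
Hypothesis ab : a < b.

(** Integrating first along [y]: the inner integral of Fubini is given by the
    fundamental theorem of calculus. *)
Lemma Rintegral_rect_dy (W Wy : R * R -> R) : continuous W -> continuous Wy ->
  (forall y t : R, is_derive y 1 (fun s => W (s, t)) (Wy (y, t))) ->
  \int[leb2 R]_(p in rect a b) Wy p =
  \int[leb]_(t in `[a, b]) W (1, t) - \int[leb]_(t in `[a, b]) W (0, t).
Proof.
move=> cW cWy dW.
have cW1 c : continuous (fun t => W (c, t)).
  by apply: continuous_pair cW _ _; [exact: cst_continuous|by move=> ?; exact: cvg_id].
rewrite -RintegralB //; try exact: continuous_itv_integrable.
congr fine; rewrite -integral_itvoo_cc; last first.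
  by move=> x; apply: cvgB; exact: cW1.
rewrite [LHS]integral_mkcond [RHS]integral_mkcond.
have imk := (integrable_mkcond _ (measurable_rect a b)).1
  (continuous_rect_integrable a b cWy).
rewrite /leb2 -integral21_prod_meas1; last exact: imk.
apply: eq_integral => t _; rewrite /fubini_G /= patchE; case: ifPn => tab.
  rewrite -(@FTC_itvoo 0 1 (fun s => W (s, t)) (fun s => Wy (s, t))) //; last first.
    by apply: continuous_pair cWy _ _; [by move=> ?; exact: cvg_id|exact: cst_continuous].
  rewrite [RHS]integral_mkcond; apply: eq_integral => y _.
  rewrite !patchE; congr (if _ then _ else _).
  by apply/idP/idP; rewrite !inE; [case|move=> ?; split=> //; move: tab; rewrite inE].
apply: integral0_eq => y _; rewrite patchE; case: ifPn => //.
by rewrite inE => -[_ /=] tt; case/negP: tab; rewrite inE.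
Qed.

(** The same in the other order of integration. *)
Lemma Rintegral_rect_dt (W Wt : R * R -> R) : continuous W -> continuous Wt ->
  (forall y t : R, is_derive t 1 (fun s => W (y, s)) (Wt (y, t))) ->
  \int[leb2 R]_(p in rect a b) Wt p =
  \int[leb]_(y in `[0, 1]) W (y, b) - \int[leb]_(y in `[0, 1]) W (y, a).
Proof.
move=> cW cWt dW.
have cW1 c : continuous (fun y => W (y, c)).
  by apply: continuous_pair cW _ _; [by move=> ?; exact: cvg_id|exact: cst_continuous].
rewrite -RintegralB //; try exact: continuous_itv_integrable.
congr fine; rewrite -integral_itvoo_cc; last first.
  by move=> x; apply: cvgB; exact: cW1.
rewrite [LHS]integral_mkcond [RHS]integral_mkcond.
have imk := (integrable_mkcond _ (measurable_rect a b)).1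
  (continuous_rect_integrable a b cWt).
rewrite /leb2 -integral12_prod_meas1; last exact: imk.
apply: eq_integral => y _; rewrite /fubini_F /= patchE; case: ifPn => yab.
  rewrite -(@FTC_itvoo a b (fun s => W (y, s)) (fun s => Wt (y, s))) //; last first.
    by apply: continuous_pair cWt _ _; [exact: cst_continuous|by move=> ?; exact: cvg_id].
  rewrite [RHS]integral_mkcond; apply: eq_integral => t _.
  rewrite !patchE; congr (if _ then _ else _).
  by apply/idP/idP; rewrite !inE; [case|move=> ?; split=> //; move: yab; rewrite inE].
apply: integral0_eq => t _; rewrite patchE; case: ifPn => //.
by rewrite inE => -[/=] tt _; case/negP: yab; rewrite inE.
Qed.

End Divergence.

End Rectangles.

(** * Integration by parts up to the trace *)

Section RealParts.
Context (R : realType) (d : measure_display) (T : measurableType d).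
Variables (mu : {measure set T -> \bar R}) (A : set T).
Hypothesis mA : measurable A.

(** Indexing the real and the imaginary part by a boolean lets one statement
    and one proof serve both. *)
Definition part (b : bool) (z : R[i]) : R :=
  if b then complex.Re z else complex.Im z.

Lemma partB b (z w : R[i]) : part b (z - w) = part b z - part b w.
Proof. by case: b z w => -[a1 a2] [b1 b2]. Qed.

Lemma normc_sqr (z : R[i]) :
  ComplexField.Normc.normc z ^+ 2 = part true z ^+ 2 + part false z ^+ 2.
Proof. by case: z => x y /=; rewrite sqr_sqrtr // addr_ge0 // sqr_ge0. Qed.

Lemma L2_part (v : T -> R[i]) b : L2 mu A v -> sqint mu A (fun x => part b (v x)).
Proof.
move=> [mre mim iv].
have mp : measurable_fun A (fun x => part b (v x)) by case: b.
split=> //; apply: (integrableR_dom mA _ iv); first exact: measurable_funX.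
move=> x _; rewrite ger0_norm ?sqr_ge0 // normc_sqr.
by case: b {mp}; rewrite ?lerDl ?lerDr sqr_ge0.
Qed.

Lemma L2norm_sqr (v : T -> R[i]) : (forall b, sqint mu A (fun x => part b (v x))) ->
  L2norm mu A v ^+ 2 = \int[mu]_(x in A) part true (v x) ^+ 2
    + \int[mu]_(x in A) part false (v x) ^+ 2.
Proof.
move=> sv; rewrite /L2norm sqr_sqrtr; last by apply: Rintegral_ge0 => x _; exact: sqr_ge0.
rewrite -RintegralD //; try by case: (sv true); case: (sv false).
by apply: eq_Rintegral => x _; rewrite normc_sqr.
Qed.

Lemma part_le_L2norm (v : T -> R[i]) b :
  (forall b, sqint mu A (fun x => part b (v x))) ->
  Num.sqrt (\int[mu]_(x in A) part b (v x) ^+ 2) <= L2norm mu A v.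
Proof.
move=> sv; rewrite -[leRHS]ger0_norm ?sqrtr_ge0 // -sqrtr_sqr ler_wsqrtr //.
have n0 b' : 0 <= \int[mu]_(x in A) part b' (v x) ^+ 2.
  by apply: Rintegral_ge0 => x _; exact: sqr_ge0.
by rewrite L2norm_sqr //; case: b; rewrite ?lerDl ?lerDr.
Qed.

(** [L2norm] is defined through an integral that makes sense only under
    integrability, which is why square integrability of all parts is required
    before convergence can be read off the parts. *)
Lemma cvg_part (v_ : nat -> T -> R[i]) (v : T -> R[i]) b :
  (forall n b, sqint mu A (fun x => part b (v_ n x))) ->
  (forall b, sqint mu A (fun x => part b (v x))) ->
  (fun n => L2norm mu A (fun x => v_ n x - v x)) @ \oo --> (0 : R) ->
  (fun n => Num.sqrt (\int[mu]_(x in A) (part b (v_ n x) - part b (v x)) ^+ 2))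
    @ \oo --> (0 : R).
Proof.
move=> sv_ sv cv; apply: squeeze_cvgr (@cvg_cst _ (0 : R) _ _ _) cv.
near=> n; rewrite sqrtr_ge0 /=.
have := @part_le_L2norm (fun x => v_ n x - v x) b.
under eq_Rintegral do rewrite partB.
apply=> b'; under eq_fun do rewrite partB.
exact: sqint_B.
Unshelve. all: by end_near. Qed.

End RealParts.

(** A directional derivative is the ordinary derivative along a line; [c]
    parametrises the line with velocity [v]. *)
Lemma is_derive_along (R : realType) (V : normedModType R) (f : V -> R)
    (c : R -> V) (v : V) (s : R) : (forall h, c (h + s) = h *: v + c s) ->
  derivable f (c s) v -> is_derive s 1 (fun s => f (c s)) ('D_v f (c s)).
Proof.
move=> cE df.
have E : (fun h : R => h^-1 *: ((f \o shift (c s)) (h *: v) - f (c s))) =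
    (fun h : R => h^-1 *: (((fun s => f (c s)) \o shift s) (h *: (1 : R)) - f (c s))).
  by apply/funext => h /=; rewrite -cE /GRing.scale /= mulr1.
by split; [rewrite /derivable -E|rewrite /derive -E].
Qed.

Lemma cvg_eq_limit (R : realType) (u v : nat -> R) (l m : R) :
  u @ \oo --> l -> v @ \oo --> m -> u =1 v -> l = m.
Proof.
move=> ul vm /funext uv; rewrite -uv in vm.
exact: (cvg_unique (@Rhausdorff R) ul vm).
Qed.

Section Traces.
Context (R : realType) (tmin tmax : R).
Hypothesis tmin_lt : tmin < tmax.
Local Notation leb := (@lebesgue_measure R).
Local Notation rct := (rect tmin tmax).

Lemma smooth_is_derive_dy (f : R * R -> R) (y t : R) : smooth f ->
  is_derive y 1 (fun s => f (s, t)) ('D_((1, 0) : R * R) f (y, t)).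
Proof.
move=> /(_ 1%N) [_ /(_ (1, 0)) [df _]].
apply: (@is_derive_along _ _ f (fun s => (s, t))) => // h.
by congr pair; rewrite /= ?/GRing.scale /= ?mulr1 ?mulr0 ?add0r.
Qed.

Lemma smooth_is_derive_dt (f : R * R -> R) (y t : R) : smooth f ->
  is_derive t 1 (fun s => f (y, s)) ('D_((0, 1) : R * R) f (y, t)).
Proof.
move=> /(_ 1%N) [_ /(_ (0, 1)) [df _]].
apply: (@is_derive_along _ _ f (fun s => (y, s))) => // h.
by congr pair; rewrite /= ?/GRing.scale /= ?mulr1 ?mulr0 ?add0r.
Qed.

Lemma smooth_continuous (V : normedModType R) (f : V -> R) : smooth f -> continuous f.
Proof. by move=> /(_ 0%N). Qed.

Lemma smooth_continuous_derive (V : normedModType R) (f : V -> R) (v : V) :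
  smooth f -> continuous ('D_v f).
Proof. by move=> /(_ 1%N) [_ /(_ v) []]. Qed.

Lemma smooth_part (V : normedModType R) (w : V -> R[i]) b : smoothC w ->
  smooth (fun x => part b (w x)).
Proof. by case: b => -[]. Qed.

(** The fundamental theorem of calculus applied to [phi w^2]. *)
Lemma smooth_ibp_dy (w phi phiy : R * R -> R) : smooth w ->
  continuous phi -> continuous phiy ->
  (forall y t : R, is_derive y 1 (fun s => phi (s, t)) (phiy (y, t))) ->
  \int[leb2 R]_(p in rct) (phiy p * (w p * w p))
  + 2 * \int[leb2 R]_(p in rct) (phi p * (w p * 'D_((1, 0) : R * R) w p)) =
  \int[leb]_(t in `[tmin, tmax]) (phi (1, t) * (w (1, t) * w (1, t)))
  - \int[leb]_(t in `[tmin, tmax]) (phi (0, t) * (w (0, t) * w (0, t))).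
Proof.
move=> sw cphi cphiy dphi.
have cw := smooth_continuous sw.
have cwy := @smooth_continuous_derive _ _ ((1, 0) : R * R) sw.
have c1 : continuous (fun p => phiy p * (w p * w p)).
  by move=> p; apply: cvgM; [exact: cphiy|apply: cvgM; exact: cw].
have c2 : continuous (fun p => phi p * (w p * 'D_((1, 0) : R * R) w p)).
  by move=> p; apply: cvgM; [exact: cphi|apply: cvgM; [exact: cw|exact: cwy]].
rewrite -RintegralZl; [|exact: measurable_rect|exact: continuous_rect_integrable].
rewrite -RintegralD; [|exact: measurable_rect|exact: continuous_rect_integrable
  |apply: integrableR_Z; [exact: measurable_rect|exact: continuous_rect_integrable]].
apply: (@Rintegral_rect_dy _ tmin tmax (fun p => phi p * (w p * w p))
  (fun p => phiy p * (w p * w p) + 2 * (phi p * (w p * 'D_((1, 0) : R * R) w p)))).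
- by move=> p; apply: cvgM; [exact: cphi|apply: cvgM; exact: cw].
- move=> p; apply: cvgD; first exact: c1.
  by apply: cvgMl_tmp; exact: c2.
move=> y t; have dw := smooth_is_derive_dy y t sw.
apply: (is_derive_eq (is_deriveM (dphi y t) (is_deriveM dw dw))).
by rewrite /GRing.scale /= fctE /=; ring.
Qed.

(** The fundamental theorem of calculus applied to [phi w^2]. *)
Lemma smooth_ibp_dt (w phi phit : R * R -> R) : smooth w ->
  continuous phi -> continuous phit ->
  (forall y t : R, is_derive t 1 (fun s => phi (y, s)) (phit (y, t))) ->
  \int[leb2 R]_(p in rct) (phit p * (w p * w p))
  + 2 * \int[leb2 R]_(p in rct) (phi p * (w p * 'D_((0, 1) : R * R) w p)) =
  \int[leb]_(y in `[0, 1]) (phi (y, tmax) * (w (y, tmax) * w (y, tmax)))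
  - \int[leb]_(y in `[0, 1]) (phi (y, tmin) * (w (y, tmin) * w (y, tmin))).
Proof.
move=> sw cphi cphit dphi.
have cw := smooth_continuous sw.
have cwt := @smooth_continuous_derive _ _ ((0, 1) : R * R) sw.
have c1 : continuous (fun p => phit p * (w p * w p)).
  by move=> p; apply: cvgM; [exact: cphit|apply: cvgM; exact: cw].
have c2 : continuous (fun p => phi p * (w p * 'D_((0, 1) : R * R) w p)).
  by move=> p; apply: cvgM; [exact: cphi|apply: cvgM; [exact: cw|exact: cwt]].
rewrite -RintegralZl; [|exact: measurable_rect|exact: continuous_rect_integrable].
rewrite -RintegralD; [|exact: measurable_rect|exact: continuous_rect_integrable
  |apply: integrableR_Z; [exact: measurable_rect|exact: continuous_rect_integrable]].
apply: (@Rintegral_rect_dt _ _ _ tmin_lt (fun p => phi p * (w p * w p))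
  (fun p => phit p * (w p * w p) + 2 * (phi p * (w p * 'D_((0, 1) : R * R) w p)))).
- by move=> p; apply: cvgM; [exact: cphi|apply: cvgM; exact: cw].
- move=> p; apply: cvgD; first exact: c1.
  by apply: cvgMl_tmp; exact: c2.
move=> y t; have dw := smooth_is_derive_dt y t sw.
apply: (is_derive_eq (is_deriveM (dphi y t) (is_deriveM dw dw))).
by rewrite /GRing.scale /= fctE /=; ring.
Qed.

Lemma Hm_wderiv_L2 (v : R * R -> R[i]) i j : (i + j <= 1)%N ->
  Hm tmin tmax 1 v -> L2 (leb2 R) rct (wderiv tmin tmax i j v).
Proof.
move=> ij [_ /(_ i j ij) ex].
by have [] : is_wderiv tmin tmax i j v (wderiv tmin tmax i j v) := xgetPex _ ex.
Qed.

Lemma rect_cvg_mul (phi : R * R -> R) (f g : R * R -> R[i])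
    (f_ g_ : nat -> R * R -> R[i]) b : continuous phi ->
  L2 (leb2 R) rct f -> L2 (leb2 R) rct g ->
  (forall n b, continuous (fun x => part b (f_ n x))) ->
  (forall n b, continuous (fun x => part b (g_ n x))) ->
  (fun n => norm0 tmin tmax (f_ n \- f)) @ \oo --> (0 : R) ->
  (fun n => norm0 tmin tmax (g_ n \- g)) @ \oo --> (0 : R) ->
  (fun n => \int[leb2 R]_(p in rct) (phi p * (part b (f_ n p) * part b (g_ n p))))
    @ \oo --> \int[leb2 R]_(p in rct) (phi p * (part b (f p) * part b (g p))).
Proof.
move=> cphi Lf Lg cf_ cg_ cf cg.
have [M phiM] := compact_continuous_bounded (@compact_crect _ tmin tmax) cphi.
apply: (@cvg_Rintegral_mul _ _ _ _ _ (measurable_rect tmin tmax) phi M).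
- by apply: continuous_measurable_fun2 => //; exact: measurable_rect.
- by move=> p /rect_crect /phiM.
- exact: (L2_part (measurable_rect tmin tmax)).
- exact: (L2_part (measurable_rect tmin tmax)).
- by move=> n; exact: continuous_rect_sqint.
- by move=> n; exact: continuous_rect_sqint.
- apply: (cvg_part (measurable_rect tmin tmax)) => //.
    by move=> n b'; exact: continuous_rect_sqint.
  by move=> b'; exact: (L2_part (measurable_rect tmin tmax)).
- apply: (cvg_part (measurable_rect tmin tmax)) => //.
    by move=> n b'; exact: continuous_rect_sqint.
  by move=> b'; exact: (L2_part (measurable_rect tmin tmax)).
Qed.

Lemma itv_cvg_mul (a c : R) (phi : R -> R) (f : R -> R[i])
    (f_ : nat -> R -> R[i]) b : continuous phi ->
  L2 leb `[a, c] f -> (forall n b, continuous (fun x => part b (f_ n x))) ->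
  (fun n => L2norm leb `[a, c] (fun x => f_ n x - f x)) @ \oo --> (0 : R) ->
  (fun n => \int[leb]_(t in `[a, c]) (phi t * (part b (f_ n t) * part b (f_ n t))))
    @ \oo --> \int[leb]_(t in `[a, c]) (phi t * (part b (f t) * part b (f t))).
Proof.
move=> cphi Lf cf_ cf.
have [M phiM] := compact_continuous_bounded (@segment_compact _ a c) cphi.
have mI : measurable (`[a, c] : set (measurableTypeR R)) by exact: measurable_itv.
have cp : (fun n => Num.sqrt (\int[leb]_(x in `[a, c])
    (part b (f_ n x) - part b (f x)) ^+ 2)) @ \oo --> (0 : R).
  apply: (cvg_part mI) => //; first by move=> n b'; exact: continuous_itv_sqint.
  by move=> b'; exact: (L2_part mI).
apply: (@cvg_Rintegral_mul _ _ _ leb _ mI phi M) => //.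
- by apply: (measurable_funS measurableT) => //; exact: continuous_measurable_fun.
- exact: (L2_part mI).
- exact: (L2_part mI).
- by move=> n; exact: continuous_itv_sqint.
- by move=> n; exact: continuous_itv_sqint.
Qed.

Lemma part_pderiv_dy (w : R * R -> R[i]) b p :
  part b (pderivC 1 0 w p) = 'D_((1, 0) : R * R) (fun x => part b (w x)) p.
Proof. by case: b. Qed.

Lemma part_pderiv_dt (w : R * R -> R[i]) b p :
  part b (pderivC 0 1 w p) = 'D_((0, 1) : R * R) (fun x => part b (w x)) p.
Proof. by case: b. Qed.

Lemma le_sqrt_sum4 (x y z t : R) : 0 <= x -> 0 <= y -> 0 <= z -> 0 <= t ->
  let s := Num.sqrt (x ^+ 2 + y ^+ 2 + z ^+ 2 + t ^+ 2) in
  [/\ x <= s, y <= s, z <= s & t <= s].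
Proof.
move=> x0 y0 z0 t0 /=.
have := (sqr_ge0 x, sqr_ge0 y, sqr_ge0 z, sqr_ge0 t) => -[[[x2 y2] z2] t2].
by split; [rewrite -{1}(ger0_norm x0)|rewrite -{1}(ger0_norm y0)
  |rewrite -{1}(ger0_norm z0)|rewrite -{1}(ger0_norm t0)];
  rewrite -sqrtr_sqr ler_wsqrtr //; lra.
Qed.

Lemma bdry_norm_cvg (w : nat -> R * R -> R[i]) (g : R * R -> R[i]) :
  (fun n => bdry_norm tmin tmax (w n \- g)) @ \oo --> (0 : R) ->
  [/\ (fun n => L2norm leb `[tmin, tmax] (fun t => w n (0, t) - g (0, t)))
        @ \oo --> (0 : R),
      (fun n => L2norm leb `[tmin, tmax] (fun t => w n (1, t) - g (1, t)))
        @ \oo --> (0 : R),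
      (fun n => L2norm leb `[0, 1] (fun y => w n (y, tmin) - g (y, tmin)))
        @ \oo --> (0 : R) &
      (fun n => L2norm leb `[0, 1] (fun y => w n (y, tmax) - g (y, tmax)))
        @ \oo --> (0 : R)].
Proof.
move=> cw; split; apply: squeeze_cvgr (@cvg_cst _ (0 : R) _ _ _) cw;
  near=> n; rewrite sqrtr_ge0 /=; set u := w n \- g;
  have := @le_sqrt_sum4 (L2norm leb `[tmin, tmax] (fun t => u (0, t)))
    (L2norm leb `[tmin, tmax] (fun t => u (1, t)))
    (L2norm leb `[0, 1] (fun y => u (y, tmin)))
    (L2norm leb `[0, 1] (fun y => u (y, tmax)));
  by case=> //; rewrite sqrtr_ge0.
Unshelve. all: by end_near. Qed.

(** The identity [smooth_ibp_dy] for the smooth approximants of [v], at the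
    limit.  It holds for any trace [g] of [v], which lets two traces of the same
    function be compared. *)
Lemma trace_ibp_dy (v g : R * R -> R[i]) (phi phiy : R * R -> R) b :
  is_trace tmin tmax v g -> continuous phi -> continuous phiy ->
  (forall y t : R, is_derive y 1 (fun s => phi (s, t)) (phiy (y, t))) ->
  \int[leb2 R]_(p in rct) (phiy p * (part b (v p) * part b (v p)))
  + 2 * \int[leb2 R]_(p in rct)
          (phi p * (part b (v p) * part b (wderiv tmin tmax 1 0 v p))) =
  \int[leb]_(t in `[tmin, tmax]) (phi (1, t) * (part b (g (1, t)) * part b (g (1, t))))
  - \int[leb]_(t in `[tmin, tmax])
      (phi (0, t) * (part b (g (0, t)) * part b (g (0, t)))).
Proof.
move=> [Hv [g0 g1 _ _]] [w [sw cw cwy _ /bdry_norm_cvg[c0 c1 _ _]]] cphi cphiy dphi.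
have Lv := Hv.1; have Lvy := @Hm_wderiv_L2 v 1 0 isT Hv.
have sp n b' := smooth_part b' (sw n).
have cpw n b' := smooth_continuous (sp n b').
have cpwy n b' : continuous (fun x => part b' (pderivC 1 0 (w n) x)).
  under eq_fun do rewrite part_pderiv_dy.
  exact: smooth_continuous_derive.
have cs (f : R * R -> R) c : continuous f -> continuous (fun t => f (c, t)).
  by move=> cf; apply: continuous_pair cf _ _; [exact: cst_continuous|move=> ?; exact: cvg_id].
have lim1 := rect_cvg_mul (b := b) cphiy Lv Lv cpw cpw cw cw.
have lim2 := rect_cvg_mul (b := b) cphi Lv Lvy cpw cpwy cw cwy.
have cw1 n b' := cs (fun x => part b' (w n x)) 1 (cpw n b').
have cw0 n b' := cs (fun x => part b' (w n x)) 0 (cpw n b').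
have limr1 := itv_cvg_mul (b := b) (cs _ 1 cphi) g1 cw1 c1.
have limr0 := itv_cvg_mul (b := b) (cs _ 0 cphi) g0 cw0 c0.
apply: (cvg_eq_limit (cvgD lim1 (cvgMl_tmp (a := 2) lim2)) (cvgB limr1 limr0)).
move=> n; apply: etrans (smooth_ibp_dy (sp n b) cphi cphiy dphi).
by congr (_ + 2 * _); apply: eq_Rintegral => p _; rewrite part_pderiv_dy.
Qed.

(** The counterpart of [trace_ibp_dy]; here the boundary sides are
    [theta = tmin] and [theta = tmax]. *)
Lemma trace_ibp_dt (v g : R * R -> R[i]) (phi phit : R * R -> R) b :
  is_trace tmin tmax v g -> continuous phi -> continuous phit ->
  (forall y t : R, is_derive t 1 (fun s => phi (y, s)) (phit (y, t))) ->
  \int[leb2 R]_(p in rct) (phit p * (part b (v p) * part b (v p)))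
  + 2 * \int[leb2 R]_(p in rct)
          (phi p * (part b (v p) * part b (wderiv tmin tmax 0 1 v p))) =
  \int[leb]_(y in `[0, 1]) (phi (y, tmax) * (part b (g (y, tmax)) * part b (g (y, tmax))))
  - \int[leb]_(y in `[0, 1])
      (phi (y, tmin) * (part b (g (y, tmin)) * part b (g (y, tmin)))).
Proof.
move=> [Hv [_ _ g0 g1]] [w [sw cw _ cwt /bdry_norm_cvg[_ _ c0 c1]]] cphi cphit dphi.
have Lv := Hv.1; have Lvt := @Hm_wderiv_L2 v 0 1 isT Hv.
have sp n b' := smooth_part b' (sw n).
have cpw n b' := smooth_continuous (sp n b').
have cpwt n b' : continuous (fun x => part b' (pderivC 0 1 (w n) x)).
  under eq_fun do rewrite part_pderiv_dt.
  exact: smooth_continuous_derive.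
have cs (f : R * R -> R) c : continuous f -> continuous (fun y => f (y, c)).
  by move=> cf; apply: continuous_pair cf _ _; [move=> ?; exact: cvg_id|exact: cst_continuous].
have lim1 := rect_cvg_mul (b := b) cphit Lv Lv cpw cpw cw cw.
have lim2 := rect_cvg_mul (b := b) cphi Lv Lvt cpw cpwt cw cwt.
have cw1 n b' := cs (fun x => part b' (w n x)) tmax (cpw n b').
have cw0 n b' := cs (fun x => part b' (w n x)) tmin (cpw n b').
have limr1 := itv_cvg_mul (b := b) (cs _ tmax cphi) g1 cw1 c1.
have limr0 := itv_cvg_mul (b := b) (cs _ tmin cphi) g0 cw0 c0.
apply: (cvg_eq_limit (cvgD lim1 (cvgMl_tmp (a := 2) lim2)) (cvgB limr1 limr0)).
move=> n; apply: etrans (smooth_ibp_dt (sp n b) cphi cphit dphi).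
by congr (_ + 2 * _); apply: eq_Rintegral => p _; rewrite part_pderiv_dt.
Qed.

End Traces.

(** * The energy estimate for the form *)

Section Energy.
Context (R : realType) (tmin tmax : R).
Hypothesis tmin_lt : tmin < tmax.
Local Notation leb := (@lebesgue_measure R).
Local Notation rct := (rect tmin tmax).
Local Notation wdy := (wderiv tmin tmax 1 0).
Local Notation wdt := (wderiv tmin tmax 0 1).

Lemma rect_integrable_mul (phi f g : R * R -> R) : continuous phi ->
  sqint (leb2 R) rct f -> sqint (leb2 R) rct g ->
  integrableR (leb2 R) rct (fun p => phi p * (f p * g p)).
Proof.
move=> cphi sf sg; have mr := measurable_rect tmin tmax.
have [K phiK] := compact_continuous_bounded (@compact_crect _ tmin tmax) cphi.
apply: (@integrableR_bddM _ _ _ _ _ mr _ _ K).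
- exact: continuous_measurable_fun2.
- by move=> p /rect_crect /phiK.
- exact: sqint_mul.
Qed.

Lemma itv_integrable_mul (a c : R) (phi f g : R -> R) : continuous phi ->
  sqint leb `[a, c] f -> sqint leb `[a, c] g ->
  integrableR leb `[a, c] (fun t => phi t * (f t * g t)).
Proof.
move=> cphi sf sg.
have mI : measurable (`[a, c] : set (measurableTypeR R)) by exact: measurable_itv.
have [K phiK] := compact_continuous_bounded (@segment_compact _ a c) cphi.
apply: (@integrableR_bddM _ _ _ leb _ mI _ _ K) => //.
- by apply: (measurable_funS measurableT) => //; exact: continuous_measurable_fun.
- exact: sqint_mul.
Qed.

Lemma Htilde_trace (v : R * R -> R[i]) : Htilde tmin tmax v ->
  is_trace tmin tmax v (trace tmin tmax v).
Proof. by move=> [_ [g [tg _ _ _]]]; exact: (xgetPex _ (ex_intro _ g tg)). Qed.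

(** Integrals over the sides on which functions of [Htilde] vanish. *)
Lemma Rintegral_ae0 (a c : R) (phi : R -> R) (g : R -> R[i]) b :
  continuous phi -> L2 leb `[a, c] g ->
  {ae leb, forall t, t \in `[a, c] -> g t = 0} ->
  \int[leb]_(t in `[a, c]) (phi t * (part b (g t) * part b (g t))) = 0.
Proof.
move=> cphi Lg g0.
have mI : measurable (`[a, c] : set (measurableTypeR R)) by exact: measurable_itv.
have [mg _] := L2_part mI b Lg.
have mphi : measurable_fun `[a, c] phi.
  by apply: (measurable_funS measurableT) => //; exact: continuous_measurable_fun.
rewrite /Rintegral (@ae_eq_integral _ _ _ leb _ (cst 0%E)) ?integral0 //.
- by apply/measurable_EFinP; apply: measurable_funM => //; exact: measurable_funM.
- have [N [mN N0 gN]] := g0; exists N; split=> // t nt; apply: gN => gt; apply: nt.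
  by move=> It /=; rewrite gt //; case: b {mg}; rewrite /= !mulr0.
Qed.

Lemma energy_lin (x1 X1 x2 X2 s L m : R) : x1 + 2 * X1 = s -> x2 + 2 * X2 = 0 ->
  s <= 2 * L -> - (x1 + x2) <= m -> 2 * (X1 + X2 - L) <= m.
Proof. lra. Qed.

(** Integration by parts against the field [(b1, b2)], whose divergence is
    [b1y + b2t].  Two traces occur: [g], given with the boundary conditions, and
    [trace v], an arbitrary choice which appears in the form.  Integrating by
    parts against the field [(y * l(theta), 0)], which vanishes at [y = 0], for
    both of them shows that they give the same integral of [l |.|^2] over
    [y = 1]. *)
Lemma energy_part (v : R * R -> R[i]) (b1 b1y b2 b2t : R * R -> R) (l : R -> R)
    (M : R) b :
  Htilde tmin tmax v ->
  continuous b1 -> continuous b1y -> continuous b2 -> continuous b2t ->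
  continuous l ->
  (forall y t : R, is_derive y 1 (fun s => b1 (s, t)) (b1y (y, t))) ->
  (forall y t : R, is_derive t 1 (fun s => b2 (y, s)) (b2t (y, t))) ->
  (forall t, t \in `[tmin, tmax] -> b1 (1, t) - 2 * l t <= 0) ->
  (forall p, rct p -> - (b1y p + b2t p) <= M) ->
  2 * (\int[leb2 R]_(p in rct) (b1 p * (part b (v p) * part b (wdy v p)))
    + \int[leb2 R]_(p in rct) (b2 p * (part b (v p) * part b (wdt v p)))
    - \int[leb]_(t in `[tmin, tmax])
        (l t * (part b (trace tmin tmax v (1, t)) * part b (trace tmin tmax v (1, t)))))
  <= M * \int[leb2 R]_(p in rct) part b (v p) ^+ 2.
Proof.
move=> Hv cb1 cb1y cb2 cb2t cl db1 db2 b1l divM.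
have tr := Htilde_trace Hv.
have [[Lv _] [g [tg g0 gmin gmax]]] := Hv.
have [_ [Lg0 Lg1 Lgmin Lgmax] _] := tg.
have mr := measurable_rect tmin tmax.
have mI : measurable (`[tmin, tmax] : set (measurableTypeR R)) by exact: measurable_itv.
have cs (f : R * R -> R) c : continuous f -> continuous (fun t => f (c, t)).
  by move=> cf; apply: continuous_pair cf _ _; [exact: cst_continuous|move=> ?; exact: cvg_id].
have cs' (f : R * R -> R) c : continuous f -> continuous (fun y => f (y, c)).
  by move=> cf; apply: continuous_pair cf _ _; [move=> ?; exact: cvg_id|exact: cst_continuous].
have sv := L2_part mr b Lv.
have sg := L2_part mI b Lg1.
have irect (phi : R * R -> R) : continuous phi -> integrableR (leb2 R) rct
    (fun p => phi p * (part b (v p) * part b (v p))) := fun cphi =>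
  rect_integrable_mul cphi sv sv.
have iside (phi : R -> R) : continuous phi -> integrableR leb `[tmin, tmax]
    (fun t => phi t * (part b (g (1, t)) * part b (g (1, t)))) := fun cphi =>
  itv_integrable_mul cphi sg sg.
have E1 := trace_ibp_dy b tg cb1 cb1y db1.
have E2 := trace_ibp_dt tmin_lt b tg cb2 cb2t db2.
rewrite (Rintegral_ae0 b (cs _ 0 cb1) Lg0 g0) subr0 in E1.
rewrite (Rintegral_ae0 b (cs' _ tmax cb2) Lgmax gmax) in E2.
rewrite (Rintegral_ae0 b (cs' _ tmin cb2) Lgmin gmin) subr0 in E2.
have cl2 : continuous (fun p : R * R => l p.2).
  by move=> p; apply: (@continuous_comp _ _ _ (@snd R R) l); [exact: cvg_snd|exact: cl].
have cyl : continuous (fun p : R * R => p.1 * l p.2).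
  by move=> p; apply: cvgM; [exact: cvg_fst|exact: cl2].
have dyl (y t : R) : is_derive y 1 (fun s => (s, t).1 * l (s, t).2) (l (y, t).2).
  apply: (is_derive_eq (is_deriveM (is_derive_id y 1) (is_derive_cst (l t) y 1))).
  by rewrite /GRing.scale /=; ring.
(* E3 and E4 differ only in the trace, so the integrals of l over y = 1 agree. *)
have E3 := trace_ibp_dy b tg cyl cl2 dyl.
have E4 := trace_ibp_dy b tr cyl cl2 dyl.
rewrite {}E3 /= in E4.
have z0 (f : R -> R[i]) :
    \int[leb]_(t in `[tmin, tmax]) (0 * l t * (part b (f t) * part b (f t))) = 0.
  under eq_Rintegral do rewrite !mul0r.
  by rewrite /Rintegral integral0.
rewrite !z0 !subr0 in E4.
have oneE (f : R -> R[i]) : \int[leb]_(t in `[tmin, tmax]) (1 * l t * (part b (f t) * part b (f t)))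
    = \int[leb]_(t in `[tmin, tmax]) (l t * (part b (f t) * part b (f t))).
  by apply: eq_Rintegral => t _; rewrite mul1r.
rewrite !oneE in E4; rewrite -{}E4.

have side : \int[leb]_(t in `[tmin, tmax]) (b1 (1, t) * (part b (g (1, t)) * part b (g (1, t)))) <=
    2 * \int[leb]_(t in `[tmin, tmax]) (l t * (part b (g (1, t)) * part b (g (1, t)))).
  rewrite -RintegralZl //; last exact: iside.
  apply: le_Rintegral => //; first exact/iside/cs.
    by apply: integrableR_Z => //; exact: iside.
  move=> t It; rewrite -expr2 [leRHS]mulrA ler_wpM2r ?sqr_ge0 // -subr_le0.
  exact: b1l.
have inner : - (\int[leb2 R]_(p in rct) (b1y p * (part b (v p) * part b (v p)))
    + \int[leb2 R]_(p in rct) (b2t p * (part b (v p) * part b (v p)))) <=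
    M * \int[leb2 R]_(p in rct) part b (v p) ^+ 2.
  have i1 := irect _ cb1y; have i2 := irect _ cb2t.
  have i12 := integrableR_D mr i1 i2.
  rewrite -RintegralD // -mulN1r -!RintegralZl //; last by case: sv.
  apply: le_Rintegral => //; [exact: integrableR_Z|by apply: integrableR_Z => //; case: sv|].
  by move=> p rp; rewrite mulN1r -mulrDl -mulNr -expr2 ler_wpM2r ?sqr_ge0 // divM.
exact: energy_lin E1 E2 side inner.
Qed.

Lemma Re_mul_conj (z w : R[i]) : complex.Re (z * w^*%C) =
  part true z * part true w + part false z * part false w.
Proof. by case: z w => a1 a2 [w1 w2] /=; ring. Qed.

Lemma Re_form_part (X L B : R[i]) :
  complex.Re (- 'i%C * (X - 'i%C * (L - B))) =
  complex.Im X - complex.Re L + complex.Re B.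
Proof. by case: X L B => a1 a2 [l1 l2] [w1 w2] /=; ring. Qed.

(** A real symmetric matrix defines a real quadratic form on complex vectors. *)
Lemma Im_hermitian (m : 'M[R]_2) (z : 'cV[R[i]]_2) : m^T = m ->
  complex.Im (\sum_(i < 2)
    (map_mx (real_complex R) m *m z) i 0 * (z i 0)^*%C) = 0.
Proof.
move=> ms; have m01 : m (lift ord0 ord0) 0 = m 0 (lift ord0 ord0).
  by rewrite -[in LHS]ms mxE.
rewrite !big_ord_recl big_ord0 !mxE !big_ord_recl !big_ord0 !mxE m01.
by case: (z 0 0) => x1 x2; case: (z (lift ord0 ord0) 0) => y1 y2 /=; ring.
Qed.

(** The heart of the stability proof: [- i A(v, v)] has a real part bounded by
    the L^2 norm alone.  The functions [b1], [b2] and [l] are smooth extensions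
    of the coefficients, which are only known on the closed rectangle. *)
Lemma energy (D : R * R -> 'M[R]_2) (b : R * R -> 'rV[R]_2) (lam : R -> R[i])
    (b1 b1y b2 b2t : R * R -> R) (l : R -> R) (M : R) (v : R * R -> R[i]) :
  Htilde tmin tmax v ->
  (forall p, rct p -> (D p)^T = D p) ->
  (forall p, rct p -> b p 0 0 = b1 p) ->
  (forall p, rct p -> b p 0 (lift ord0 ord0) = b2 p) ->
  (forall t, t \in `[tmin, tmax] -> complex.Re (lam t) = l t) ->
  continuous b1 -> continuous b1y -> continuous b2 -> continuous b2t ->
  continuous l ->
  (forall y t : R, is_derive y 1 (fun s => b1 (s, t)) (b1y (y, t))) ->
  (forall y t : R, is_derive t 1 (fun s => b2 (y, s)) (b2t (y, t))) ->
  (forall t, t \in `[tmin, tmax] -> b1 (1, t) - 2 * l t <= 0) ->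
  (forall p, rct p -> - (b1y p + b2t p) <= M) ->
  2 * complex.Re (- 'i%C * formA tmin tmax D b lam v v) <=
    M * norm0 tmin tmax v ^+ 2.
Proof.
move=> Hv Dsym bb1 bb2 laml cb1 cb1y cb2 cb2t cl db1 db2 b1l divM.
have E b' := energy_part b' Hv cb1 cb1y cb2 cb2t cl db1 db2 b1l divM.
have [Hm1 _] := Hv; have [Lv _] := Hm1.
have [_ [_ Lg _ _] _] := Htilde_trace Hv.
have mr := measurable_rect tmin tmax.
have mI : measurable (`[tmin, tmax] : set (measurableTypeR R)) by exact: measurable_itv.
have sv b' := L2_part mr b' Lv.
have svy b' := L2_part mr b' (@Hm_wderiv_L2 _ tmin tmax v 1 0 isT Hm1).
have svt b' := L2_part mr b' (@Hm_wderiv_L2 _ tmin tmax v 0 1 isT Hm1).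
have sg b' := L2_part mI b' Lg.
have iside b' : integrableR leb `[tmin, tmax] (fun t => l t *
    (part b' (trace tmin tmax v (1, t)) * part b' (trace tmin tmax v (1, t)))).
  exact: itv_integrable_mul.
rewrite /formA Re_form_part.
have -> : complex.Im (L2inner_vec (leb2 R) rct (D_grad tmin tmax D v) (grad tmin tmax v)) = 0.
  rewrite /L2inner_vec /cintegral /=.
  transitivity (\int[leb2 R]_(p in rct) (0 : R)); last by rewrite /Rintegral integral0.
  by apply: eq_Rintegral => p /set_mem rp; apply: Im_hermitian; exact: Dsym.
have -> : complex.Re (cintegral leb `[tmin, tmax]
      (fun t => lam t * trace tmin tmax v (1, t) * (trace tmin tmax v (1, t))^*%C)) =
    \int[leb]_(t in `[tmin, tmax]) (l t *
      (part true (trace tmin tmax v (1, t)) * part true (trace tmin tmax v (1, t))))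
    + \int[leb]_(t in `[tmin, tmax]) (l t *
      (part false (trace tmin tmax v (1, t)) * part false (trace tmin tmax v (1, t)))).
  rewrite -(RintegralD mI (iside true) (iside false)); apply: eq_Rintegral => t /set_mem It.
  rewrite -(laml t It); case: (lam t) => l1 l2; case: (trace _ _ _ _) => g1 g2 /=.
  ring.
have -> : complex.Re (inner tmin tmax (b_grad tmin tmax b v) v) =
  (\int[leb2 R]_(p in rct) (b1 p * (part true (v p) * part true (wdy v p)))
   + \int[leb2 R]_(p in rct) (b2 p * (part true (v p) * part true (wdt v p))))
  + (\int[leb2 R]_(p in rct) (b1 p * (part false (v p) * part false (wdy v p)))
   + \int[leb2 R]_(p in rct) (b2 p * (part false (v p) * part false (wdt v p)))).
  have i1 b' := rect_integrable_mul cb1 (sv b') (svy b').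
  have i2 b' := rect_integrable_mul cb2 (sv b') (svt b').
  have i12 b' := integrableR_D mr (i1 b') (i2 b').
  rewrite -(RintegralD mr (i1 true) (i2 true)) -(RintegralD mr (i1 false) (i2 false)).
  rewrite -(RintegralD mr (i12 true) (i12 false)).
  apply: eq_Rintegral => p /set_mem rp.
  rewrite -(bb1 p rp) -(bb2 p rp) /b_grad !mxE !big_ord_recl big_ord0 !mxE /=.
  case: (wdy v p) => p1 p2; case: (wdt v p) => q1 q2; case: (v p) => v1 v2 /=.
  ring.
have sum2 (x x' y y' l1 l2 n n' : R) : 2 * (x + y - l1) <= M * n ->
    2 * (x' + y' - l2) <= M * n' ->
    2 * (0 - (l1 + l2) + (x + y + (x' + y'))) <= M * (n + n').
  by clear; lra.
by rewrite L2norm_sqr //; exact: sum2 (E true) (E false).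
Qed.

End Energy.

(** * Discrete Gronwall lemma and the nodes of the scheme *)

Section Stability.
Context (R : realType).

(** The bound [a n <= (1 + x)^n (a 0 + n y)] is proved by induction, and
    [1 + x <= exp x]. *)
Lemma discrete_gronwall (a : nat -> R) (x y : R) (N : nat) : 0 <= x -> 0 <= y ->
  (forall n, (n < N)%N -> a n.+1 <= (1 + x) * a n + y) -> (forall n, 0 <= a n) ->
  forall n, (n <= N)%N -> a n <= expR (N%:R * x) * (a 0%N + N%:R * y).
Proof.
move=> x0 y0 rec a0 n nN.
have H : a n <= (1 + x) ^+ n * (a 0%N + n%:R * y).
  elim: n nN => [|n IH] nN; first by rewrite expr0 mul0r addr0 mul1r.
  apply: le_trans (rec n nN) _.
  have p1 : 1 <= (1 + x) ^+ n.+1 by rewrite exprn_ege1 // lerDl.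
  have : (1 + x) * a n <= (1 + x) ^+ n.+1 * (a 0%N + n%:R * y).
    by rewrite exprS -mulrA ler_wpM2l ?addr_ge0 // IH // ltnW.
  have -> : (1 + x) ^+ n.+1 * (a 0%N + n.+1%:R * y) =
    (1 + x) ^+ n.+1 * (a 0%N + n%:R * y) + (1 + x) ^+ n.+1 * y.
    by rewrite -natr1; ring.
  have : y <= (1 + x) ^+ n.+1 * y by rewrite ler_peMl.
  lra.
apply: le_trans H _; apply: ler_pM.
- by rewrite exprn_ge0 // addr_ge0.
- by rewrite addr_ge0 // mulr_ge0.
- apply: le_trans (_ : expR x ^+ n <= _).
    by rewrite lerXn2r ?nnegrE ?addr_ge0 ?expR_ge0 // expR_ge1Dx.
  by rewrite -expRM_natl ler_expR ler_wpM2r // ler_nat.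
- by rewrite lerD2l ler_wpM2r // ler_nat.
Qed.

Lemma midnode_itv (rmin rmax : R) (N n : nat) : rmin < rmax -> (n < N)%N ->
  midnode rmin rmax N n \in `[rmin, rmax].
Proof.
move=> rr nN; have N0 : (0 : R) < N%:R by rewrite ltr0n; case: N nN.
have k0 : 0 < step rmin rmax N by rewrite /step divr_gt0 // subr_gt0.
have Nk : N%:R * step rmin rmax N = rmax - rmin by rewrite /step; field; lra.
rewrite /midnode /node; set k := step _ _ _ in k0 Nk *.
have n0 : 0 <= n%:R * k by rewrite mulr_ge0 // ltW.
have n1 : n.+1%:R * k <= N%:R * k by rewrite ler_wpM2r ?(ltW k0) // ler_nat.
rewrite -natr1 in n1 *; rewrite in_itv /=; apply/andP; split; lra.
Qed.

Lemma finite_dim_space_midpoint (S : set (R * R -> R[i])) (u v : R * R -> R[i]) :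
  finite_dim_space S -> S u -> S v -> S (fun p => (u p + v p) / 2).
Proof.
move=> [m [e ->]] [a _ <-] [c _ <-]; exists (fun i => (a i + c i) / 2) => //.
apply/funext => p; rewrite -big_split mulr_suml.
by apply: eq_bigr => i _ /=; field.
Qed.

End Stability.

(** * Terms of the scheme tested with the midpoint *)

Section StepInequality.
Context (R : realType) (tmin tmax : R).
Local Notation rct := (rect tmin tmax).
Local Notation norm v := (norm0 tmin tmax v).

Let mr := @measurable_rect R tmin tmax.

Definition L2rect (v : R * R -> R[i]) : Prop :=
  forall b, sqint (leb2 R) rct (fun p => part b (v p)).

Lemma norm0_sqr v : L2rect v -> norm v ^+ 2 =
  \int[leb2 R]_(p in rct) (part true (v p) ^+ 2 + part false (v p) ^+ 2).
Proof.
move=> sv; rewrite [LHS](L2norm_sqr mr) // -RintegralD //; first by case: (sv true).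
by case: (sv false).
Qed.

Lemma norm0_integrable v : L2rect v -> integrableR (leb2 R) rct
  (fun p => part true (v p) ^+ 2 + part false (v p) ^+ 2).
Proof. by move=> sv; apply: integrableR_D => //; [case: (sv true)|case: (sv false)]. Qed.

Lemma L2rect_midpoint u v : L2rect u -> L2rect v -> L2rect (fun p => (u p + v p) / 2).
Proof.
move=> su sv b; have := sqint_Z mr (2^-1) (sqint_D mr (su b) (sv b)).
congr sqint; apply/funext => p.
have -> : (2 : R[i])^-1 = (2^-1)%:C%C by rewrite rmorphV ?unitfE ?pnatr_eq0 //= rmorph_nat.
by case: b; case: (u p) => u1 u2; case: (v p) => v1 v2 /=; ring.
Qed.

(** Convexity of the square; with it the step inequality is linear in squared
    norms. *)
Lemma norm0_midpoint u v : L2rect u -> L2rect v ->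
  norm (fun p => (u p + v p) / 2) ^+ 2 <= (norm u ^+ 2 + norm v ^+ 2) / 2.
Proof.
move=> su sv; have sm := L2rect_midpoint su sv.
have iu := norm0_integrable su; have iv := norm0_integrable sv.
rewrite !norm0_sqr // -RintegralD // mulrC -RintegralZl //; last exact: integrableR_D.
apply: le_Rintegral => //; first exact: norm0_integrable.
  by apply: integrableR_Z => //; exact: integrableR_D.
move=> p _.
have -> : (2 : R[i])^-1 = (2^-1)%:C%C by rewrite rmorphV ?unitfE ?pnatr_eq0 //= rmorph_nat.
case: (u p) => u1 u2; case: (v p) => v1 v2 /=.
by have := sqr_ge0 (u1 - v1); have := sqr_ge0 (u2 - v2); nra.
Qed.

(** [(U - V) conj (U + V)] has real part [|U|^2 - |V|^2]. *)
Lemma Re_inner_difference u v (k : R) : k != 0 -> L2rect u -> L2rect v ->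
  complex.Re (inner tmin tmax (fun p => (u p - v p) / k%:C%C)
                              (fun p => (u p + v p) / 2)) =
  (norm u ^+ 2 - norm v ^+ 2) / (2 * k).
Proof.
move=> k0 su sv; have iu := norm0_integrable su; have iv := norm0_integrable sv.
rewrite !norm0_sqr // -RintegralB // mulrC -RintegralZl //; last exact: integrableR_B.
apply: eq_Rintegral => p _.
have -> : (2 : R[i])^-1 = (2^-1)%:C%C by rewrite rmorphV ?unitfE ?pnatr_eq0 //= rmorph_nat.
have -> : (k%:C%C)^-1 = (k^-1)%:C%C by rewrite rmorphV ?unitfE.
by case: (u p) => u1 u2; case: (v p) => v1 v2 /=; field.
Qed.

(** Only the imaginary part of [beta] contributes, since [(beta v, v)] is the
    integral of [beta |v|^2]. *)
Lemma Re_inner_mul_le (beta : R * R -> R[i]) v (M : R) :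
  measurable_fun (rct : set (measurableTypeR R * measurableTypeR R))
    (fun p => complex.Im (beta p)) ->
  (forall p, rct p -> `|complex.Im (beta p)| <= M) -> L2rect v ->
  complex.Re ('i%C * inner tmin tmax (fun p => beta p * v p) v) <= M * norm v ^+ 2.
Proof.
move=> mb bM sv; have iv := norm0_integrable sv.
have -> : complex.Re ('i%C * inner tmin tmax (fun p => beta p * v p) v) =
    - \int[leb2 R]_(p in rct) (complex.Im (beta p) *
        (part true (v p) ^+ 2 + part false (v p) ^+ 2)).
  rewrite /inner /L2inner /cintegral /= mul0r mul1r sub0r; congr (- _).
  apply: eq_Rintegral => p _.
  by case: (beta p) => b1 b2; case: (v p) => v1 v2 /=; ring.
have ib := integrableR_bddM mr mb bM iv.
rewrite norm0_sqr // -mulN1r -!RintegralZl //.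
apply: le_Rintegral => //; [exact: integrableR_Z|exact: integrableR_Z|].
move=> p rp; rewrite mulN1r -mulNr ler_wpM2r ?addr_ge0 ?sqr_ge0 //.
by rewrite (le_trans _ (bM p rp)) // -normrN ler_norm.
Qed.

(** Young's inequality, pointwise. *)
Lemma Re_inner_le f v : L2rect f -> L2rect v ->
  complex.Re (inner tmin tmax f v) <= (norm f ^+ 2 + norm v ^+ 2) / 2.
Proof.
move=> sf sv; have iF := norm0_integrable sf; have iv := norm0_integrable sv.
rewrite !norm0_sqr // -RintegralD // mulrC -RintegralZl //; last exact: integrableR_D.
have E : (fun p => complex.Re (f p * (v p)^*%C)) = (fun p =>
    part true (f p) * part true (v p) + part false (f p) * part false (v p)).
  by apply/funext => p; exact: Re_mul_conj.
rewrite /inner /L2inner /cintegral /= E.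
apply: le_Rintegral => //.
- by apply: integrableR_D => //; exact: sqint_mul.
- by apply: integrableR_Z => //; exact: integrableR_D.
move=> p _.
have := sqr_ge0 (part true (f p) - part true (v p)).
have := sqr_ge0 (part false (f p) - part false (v p)); nra.
Qed.

End StepInequality.

(** * Slices of the coefficients at fixed r *)

Section Coefficients.
Context (R : realType) (rmin rmax tmin tmax : R).
Local Notation box := (`[rmin, rmax] `*` crect tmin tmax).

Lemma continuous_slice (V W : topologicalType) (g : V * W -> R) (r : V) :
  continuous g -> continuous (fun p => g (r, p)).
Proof.
by move=> cg; apply: continuous_pair cg _ _;
  [exact: cst_continuous|move=> ?; exact: cvg_id].
Qed.

Lemma smooth_slice_dy (g : R * (R * R) -> R) (r y t : R) : smooth g ->
  is_derive y 1 (fun s => g (r, (s, t))) ('D_((0, (1, 0)) : R * (R * R)) g (r, (y, t))).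
Proof.
move=> /(_ 1%N) [_ /(_ (0, (1, 0))) [dg _]].
apply: (@is_derive_along _ _ g (fun s => (r, (s, t)))) => // h.
by congr pair; [|congr pair]; rewrite /= ?/GRing.scale /= ?mulr1 ?mulr0 ?add0r.
Qed.

Lemma smooth_slice_dt (g : R * (R * R) -> R) (r y t : R) : smooth g ->
  is_derive t 1 (fun s => g (r, (y, s))) ('D_((0, (0, 1)) : R * (R * R)) g (r, (y, t))).
Proof.
move=> /(_ 1%N) [_ /(_ (0, (0, 1))) [dg _]].
apply: (@is_derive_along _ _ g (fun s => (r, (y, s)))) => // h.
by congr pair; [|congr pair]; rewrite /= ?/GRing.scale /= ?mulr1 ?mulr0 ?add0r.
Qed.

Lemma compact_box : compact box.
Proof. by apply: compact_setX; [exact: segment_compact|exact: compact_crect]. Qed.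

Lemma smoothC_on_L2rect (F : R -> R * R -> R[i]) (r : R) : r \in `[rmin, rmax] ->
  smoothC_on box (fun x => F x.1 x.2) -> L2rect tmin tmax (F r).
Proof.
move=> rI [G sG FG] b.
have cG : continuous (fun p => part b (G (r, p))).
  apply: (@continuous_slice _ _ (fun x => part b (G x))).
  exact: smooth_continuous (smooth_part b sG).
have [mG iG] := continuous_rect_sqint tmin tmax cG.
have E p : rect tmin tmax p -> F r p = G (r, p).
  by move=> /rect_crect cp; apply: (FG (r, p)); rewrite inE; split.
split.
  apply: eq_measurable_fun mG => p; rewrite inE => rp.
  by rewrite E.
apply: eq_integrable iG; first exact: measurable_rect.
by move=> p; rewrite inE => rp /=; rewrite E.
Qed.

End Coefficients.

(** * Stability *)

(** The real inequality behind one step, with [a0], [a1], [m], [f], [Fm] the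
    squared norms of [U^n], [U^(n+1)], [V], [F] and the maximum of [|F|], and
    [A], [B], [C] the real parts of the three terms on the right of the scheme.
    With [x = k K <= 1/2] it amounts to [(1 + x) / (1 - x) <= 1 + 4 x] and
    [1 / (1 - x) <= 2]. *)
Lemma crank_nicolson_step (R : realType) (a0 a1 m f Fm A B C K M M' k : R) :
  0 < k -> 0 <= a0 -> 0 <= a1 -> 0 <= M -> 0 <= M' -> 0 <= Fm ->
  K = M / 2 + M' + 2^-1 -> k * K <= 2^-1 ->
  2 * A <= M * m -> B <= M' * m -> C <= (f + m) / 2 -> m <= (a1 + a0) / 2 ->
  f <= Fm -> (a1 - a0) / (2 * k) = A + B + C ->
  a1 <= (1 + 4 * K * k) * a0 + 2 * k * Fm.
Proof.
move=> k0 a00 a10 M0 M'0 F0 KE kK hA hB hC hm hf E.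
have K0 : 0 < K by rewrite KE; lra.
have h1 : a1 - a0 <= 2 * k * (K * ((a1 + a0) / 2) + Fm / 2).
  have -> : a1 - a0 = 2 * k * ((a1 - a0) / (2 * k)) by field; lra.
  rewrite E ler_wpM2l //; first by lra.
  have : K * m <= K * ((a1 + a0) / 2) by rewrite ler_wpM2l // ltW.
  have -> : K * m = M * m / 2 + M' * m + m / 2 by rewrite KE; field.
  lra.
set x := k * K in kK.
have x0 : 0 < x by rewrite mulr_gt0.
have h2 : a1 * (1 - x) <= a0 * (1 + x) + k * Fm.
  have -> : a0 * (1 + x) + k * Fm = a0 + 2 * k * (K * ((a1 + a0) / 2) + Fm / 2) - a1 * x.
    by rewrite /x; field.
  lra.
have Fm0 : 0 <= k * Fm.
  by rewrite mulr_ge0 // ltW.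
have -> : (1 + 4 * K * k) * a0 + 2 * k * Fm = (1 + 4 * x) * a0 + 2 * (k * Fm).
  by rewrite /x; ring.
have x1 : 0 < 1 - x by lra.
rewrite -(ler_pM2r x1); apply: le_trans h2 _.
have := mulr_ge0 (mulr_ge0 (ltW x0) a00) (_ : 0 <= 1 - 2 * x).
have := mulr_ge0 Fm0 (_ : 0 <= 1 - 2 * x).
nra.
Qed.


Theorem theorem3p5 (R : realType) (rmin rmax tmin tmax : R)
    (hr : rmin < rmax) (ht : tmin < tmax)
    (D : R -> R * R -> 'M[R]_2) (b : R -> R * R -> 'rV[R]_2)
    (beta : R -> R * R -> R[i]) (lam : R -> R -> R[i])
    (D_smooth : forall i j,
       smooth_on (`[rmin, rmax] `*` crect tmin tmax)
         (fun x : R * (R * R) => D x.1 x.2 i j))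
    (b_smooth : forall j,
       smooth_on (`[rmin, rmax] `*` crect tmin tmax)
         (fun x : R * (R * R) => b x.1 x.2 0 j))
    (beta_smooth :
       smoothC_on (`[rmin, rmax] `*` crect tmin tmax)
         (fun x : R * (R * R) => beta x.1 x.2))
    (lam_smooth :
       smoothC_on (`[rmin, rmax] `*` `[tmin, tmax])
         (fun x : R * R => lam x.1 x.2))
    (D_sym : forall r p, r \in `[rmin, rmax] -> crect tmin tmax p ->
       (D r p)^T = D r p)
    (D_det : forall r p, r \in `[rmin, rmax] -> crect tmin tmax p ->
       0 < \det (D r p))
    (b_lam : forall r t, r \in `[rmin, rmax] -> t \in `[tmin, tmax] ->
       b r (1, t) 0 0 - 2 * complex.Re (lam r t) <= 0)
    (tau : nat) (tau_ge1 : (1 <= tau)%N)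
    (hstar : R) (hstar_gt0 : 0 < hstar)
    (Sh : R -> set (R * R -> R[i]))
    (Sh_fe : forall h, 0 < h <= hstar -> fe_space tmin tmax tau h (Sh h))
    (Sh_approx : approximation_property tmin tmax tau hstar Sh)
    (Sh_inverse : inverse_property tmin tmax hstar Sh) :
  exists c k0 : R, [/\ 0 < c, 0 < k0 &
    forall F : R -> R * R -> R[i],
      smoothC_on (`[rmin, rmax] `*` crect tmin tmax)
        (fun x : R * (R * R) => F x.1 x.2) ->
    forall (h : R) (N : nat), 0 < h <= hstar -> (1 < N)%N ->
      step rmin rmax N <= k0 ->
    forall U : nat -> R * R -> R[i],
      (forall n, (n <= N)%N -> Sh h (U n)) ->
      cn_scheme rmin rmax tmin tmax D b beta F lam (Sh h) N U ->
    forall n, (1 <= n <= N)%N ->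
      norm0 tmin tmax (U n) <=
        c * norm0 tmin tmax (U 0%N)
        + c * \big[Num.max/0]_(m < N) norm0 tmin tmax (F (midnode rmin rmax N m))].
Proof.
have [g1 sg1 bg1] := b_smooth 0.
have [g2 sg2 bg2] := b_smooth (lift ord0 ord0).
have [gb sgb betagb] := beta_smooth.
have [gl sgl lamgl] := lam_smooth.
pose box : set (R * (R * R)) := `[rmin, rmax] `*` crect tmin tmax.
have cbox : compact box by exact: compact_box.
have cdy : continuous ('D_((0, (1, 0)) : R * (R * R)) g1).
  exact: smooth_continuous_derive.
have cdt : continuous ('D_((0, (0, 1)) : R * (R * R)) g2).
  exact: smooth_continuous_derive.
have [M1 bM1] := compact_continuous_bounded cbox cdy.
have [M2 bM2] := compact_continuous_bounded cbox cdt.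
have cgb : continuous (fun x => complex.Im (gb x)).
  exact: smooth_continuous (smooth_part false sgb).
have [M3 bM3] := compact_continuous_bounded cbox cgb.
(* M1 + M2 bounds the divergence of b and M3 the imaginary part of beta, for all
   r; the last 1/2 comes from the term with F. *)
pose K : R := (`|M1| + `|M2|) / 2 + `|M3| + 2^-1.
have K0 : 0 < K.
  have := normr_ge0 M1; have := normr_ge0 M2; have := normr_ge0 M3; rewrite /K; lra.
pose T := rmax - rmin.
have T0 : 0 < T by rewrite subr_gt0.
(* expR (4 K T) (1 + 2 T) is the constant for the squared norms; being at least
   1, it is below its own square and also serves for the norms. *)
pose c := expR (T * (4 * K)) * (1 + 2 * T).
have c1 : 1 <= c.
  apply: mulr_ege1; last by lra.
  by rewrite -expR0 ler_expR !mulr_ge0 // ltW.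
exists c, (2 * K)^-1; split; [lra|by rewrite invr_gt0 mulr_gt0|].
move=> F F_smooth h N hh N1 kk0 U US scheme n /andP[n1 nN].
have [Sfin SH _] := Sh_fe h hh.
have LU m : (m <= N)%N -> L2rect tmin tmax (U m).
  move=> /US /SH [[LUm _] _] b'.
  exact: (L2_part (measurable_rect tmin tmax)).
set Fmax := \big[Num.max/0]_(m < N) _.
have FmaxP m : (m < N)%N -> norm0 tmin tmax (F (midnode rmin rmax N m)) <= Fmax.
  move=> mN; exact: (le_bigmax _
    (fun m : 'I_N => norm0 tmin tmax (F (midnode rmin rmax N m))) (Ordinal mN)).
have Fmax0 : 0 <= Fmax by exact: bigmax_ge_id.
set k := step rmin rmax N in kk0.
have N0 : (0 : R) < N%:R by rewrite ltr0n ltnW.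
have k0 : 0 < k by rewrite /k /step divr_gt0.
have Nk : N%:R * k = T by rewrite /k /step /T; field; lra.
have kK : k * K <= 2^-1.
  by rewrite -ler_pdivlMr // -invfM.
pose a m := norm0 tmin tmax (U m) ^+ 2.
have one_step m : (m < N)%N -> a m.+1 <= (1 + 4 * K * k) * a m + 2 * k * Fmax ^+ 2.
  move=> mN; pose r := midnode rmin rmax N m.
  have rI : r \in `[rmin, rmax] by exact: midnode_itv.
  pose V := fun p => (U m.+1 p + U m p) / 2.
  have sU0 := LU m (ltnW mN); have sU1 := LU m.+1 mN.
  have sV : L2rect tmin tmax V by exact: L2rect_midpoint.
  have SV : Sh h V by apply: finite_dim_space_midpoint; [|exact: US|exact/US/ltnW].
  have HV : Htilde tmin tmax V by exact: SH.
  have sF := smoothC_on_L2rect rI F_smooth.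
  have boxI p : crect tmin tmax p -> box (r, p) by [].
  have := scheme m mN V SV => /= /(congr1 (@complex.Re R)).
  rewrite Re_inner_difference ?gt_eqF // !raddfD /= -/r -/V.
  have energyV : 2 * complex.Re (- 'i%C * formA tmin tmax (D r) (b r) (lam r) V V) <=
      (`|M1| + `|M2|) * norm0 tmin tmax V ^+ 2.
    apply: (@energy _ _ _ ht (D r) (b r) (lam r)
      (fun p => g1 (r, p)) (fun p => 'D_((0, (1, 0)) : R * (R * R)) g1 (r, p))
      (fun p => g2 (r, p)) (fun p => 'D_((0, (0, 1)) : R * (R * R)) g2 (r, p))
      (fun t => complex.Re (gl (r, t)))) => //.
    - by move=> p /rect_crect; exact: D_sym.
    - by move=> p /rect_crect /boxI rp; apply: (bg1 (r, p)); rewrite inE.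
    - by move=> p /rect_crect /boxI rp; apply: (bg2 (r, p)); rewrite inE.
    - move=> t tI; congr complex.Re.
      by apply: (lamgl (r, t)); rewrite inE; split.
    - by apply: continuous_slice; exact: smooth_continuous.
    - exact: (continuous_slice (r := r) cdy).
    - by apply: continuous_slice; exact: smooth_continuous.
    - exact: (continuous_slice (r := r) cdt).
    - apply: (@continuous_slice _ _ _ (fun x => complex.Re (gl x))).
      exact: smooth_continuous (smooth_part true sgl).
    - by move=> y t; exact: smooth_slice_dy.
    - by move=> y t; exact: smooth_slice_dt.
    - move=> t tI; have := b_lam r t rI tI.
      have -> : b r (1, t) 0 0 = g1 (r, (1, t)).
        apply: (bg1 (r, (1, t))); rewrite inE; split=> //; split=> //=.
        by rewrite in_itv /= ler01 lexx.
      by have -> : lam r t = gl (r, t) by apply: (lamgl (r, t)); rewrite inE; split.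
    - move=> p /rect_crect /boxI rp.
      have := bM1 _ rp; have := bM2 _ rp; rewrite !ler_norml => /andP[x1 _] /andP[x2 _].
      have := ler_norm M1; have := ler_norm M2; lra.
  have betaV : complex.Re ('i%C * inner tmin tmax (fun p => beta r p * V p) V) <=
      `|M3| * norm0 tmin tmax V ^+ 2.
    have E p : rect tmin tmax p -> beta r p = gb (r, p).
      by move=> /rect_crect /boxI rp; apply: (betagb (r, p)); rewrite inE.
    apply: Re_inner_mul_le => //.
      apply: (@eq_measurable_fun _ _ _ _ _ (fun p => complex.Im (gb (r, p)))).
        by move=> p; rewrite inE => rp; rewrite E.
      apply: continuous_measurable_fun2; first exact: measurable_rect.
      by apply: (@continuous_slice _ _ _ (fun x => complex.Im (gb x))).
    move=> p rp; rewrite E //; apply: le_trans (ler_norm _).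
    exact/bM3/boxI/rect_crect.
  have FV := Re_inner_le sF sV.
  have midV : norm0 tmin tmax V ^+ 2 <= (a m.+1 + a m) / 2 := norm0_midpoint sU1 sU0.
  have F2 : norm0 tmin tmax (F r) ^+ 2 <= Fmax ^+ 2.
    by rewrite lerXn2r ?nnegrE ?sqrtr_ge0 // FmaxP.
  move: energyV betaV FV midV F2; rewrite -/k -/(a m.+1) -/(a m).
  by apply: crank_nicolson_step => //; rewrite ?sqr_ge0 ?addr_ge0.
have aN := @discrete_gronwall R a (4 * K * k) (2 * k * Fmax ^+ 2) N _ _ one_step _ n nN.
have : norm0 tmin tmax (U n) ^+ 2 <= (c * (norm0 tmin tmax (U 0%N) + Fmax)) ^+ 2.
  apply: le_trans (aN _ _ _) _.
  - by rewrite !mulr_ge0 // ltW.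
  - by rewrite !mulr_ge0 // ?sqr_ge0 // ltW.
  - by move=> m; exact: sqr_ge0.
  have -> : N%:R * (4 * K * k) = T * (4 * K) by rewrite -Nk; ring.
  have -> : N%:R * (2 * k * Fmax ^+ 2) = 2 * T * Fmax ^+ 2 by rewrite -Nk; ring.
  rewrite /a; set u := norm0 _ _ _.
  have u0 : 0 <= u by exact: sqrtr_ge0.
  apply: le_trans (_ : c * (u + Fmax) ^+ 2 <= _); last first.
    by rewrite exprMn ler_wpM2r ?sqr_ge0 // ler_eXnr.
  rewrite /c -[leRHS]mulrA ler_wpM2l ?expR_ge0 //.
  have := sqr_ge0 u; have := mulr_ge0 (ltW T0) (sqr_ge0 u).
  have := sqr_ge0 Fmax; have := mulr_ge0 u0 Fmax0.
  have := mulr_ge0 (ltW T0) (mulr_ge0 u0 Fmax0); nra.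
rewrite ler_sqr ?nnegrE ?sqrtr_ge0 ?mulr_ge0 ?addr_ge0 ?sqrtr_ge0 //; last lra.
by rewrite mulrDr.
Qed.
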